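(* Assume that there is $p>6$ such that $\tau_p=\mathbb{E}[|\varepsilon_i|^p]<\infty$ for all $i$, and that there is $c\in(0,1)$, not depending on $n$, such that $$c\,\rho^2(P_n)\dim(S_m)\le\mathrm{Tr}({}^tP_n\pi_mP_n)\quad\text{for all }m\in\mathcal{M}.$$ Let $A>0$ and $\omega>0$ be such that $$N_0\le1\quad\text{and}\quad\sup_{d>0:N_d>0}\frac{N_d}{(1+d)^{p/2-3-\omega}}\le A.$$ Let $L,\theta,\omega'$ be positive numbers satisfying $L\ge\omega'A^{2/(p-2)}$. Then the estimator $\tilde s=\hat s_{\hat m}$ obtained with the penalty function $$\mathrm{pen}(m)=(1+\theta+L)\frac{\mathrm{Tr}({}^tP_n\pi_mP_n)}{n}\sigma^2$$ satisfies $$\mathbb{E}\left[\|s-\tilde s\|_n^2\right]\le C\tau_p\inf_{m\in\mathcal{M}}\left\{\|s-s_m\|_n^2+(L\vee1)\frac{\mathrm{Tr}({}^tP_n\pi_mP_n)\vee(c\rho^2(P_n))}{n}\sigma^2\right\},$$ where $C>1$ depends only on $\theta$, $p$, $\omega$, $\omega'$ and $c$.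
   Context: For $x\in\mathbb{R}^n$: $\|x\|_n^2=\frac1n\sum_{i=1}^nx_i^2$. For a real $n\times n$ matrix $A$, $\rho(A)=\sup_{x\ne0}\|Ax\|_n/\|x\|_n$ is the spectral norm, and ${}^tA$ is the transpose; $a\vee b=\max(a,b)$. One observes $Y=s+\sigma P_n\varepsilon\in\mathbb{R}^n$, where $P_n$ is a known real $n\times n$ matrix (not necessarily invertible), $s\in\mathrm{Im}(P_n)$ is unknown and deterministic, $\sigma>0$ is known, and $\varepsilon=(\varepsilon_1,\dots,\varepsilon_n)'$ is a random vector with i.i.d. centered components of unit variance. $\{S_m,\ m\in\mathcal{M}\}$ is a finite or countable collection of linear subspaces of $\mathrm{Im}(P_n)$; $\pi_m$ is the orthogonal projection onto $S_m$; $s_m=\pi_ms$; $\hat s_m=\pi_mY$. For $d\in\mathbb{N}$, $N_d$ is the number of $m\in\mathcal{M}$ with $\dim(S_m)=d$. Given a penalty function $\mathrm{pen}:\mathcal{M}\to\mathbb{R}_+$, $\hat m$ is any minimizer over $m\in\mathcal{M}$ of $\|Y-\hat s_m\|_n^2+\mathrm{pen}(m)$, and $\tilde s=\hat s_{\hat m}$. *)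

(* Defs.v *)
From mathcomp Require Import all_boot all_order all_algebra.
From mathcomp Require Import all_classical all_reals all_analysis.

Set Implicit Arguments.
Unset Strict Implicit.
Unset Printing Implicit Defensive.

Import Order.TTheory GRing.Theory Num.Theory.
Import numFieldNormedType.Exports.

Local Open Scope classical_set_scope.
Local Open Scope ring_scope.

Definition normn (R : realType) (n : nat) (x : 'cV[R]_n) : R :=
  Num.sqrt (n%:R^-1 * \sum_(i < n) x i 0 ^+ 2).

Definition specnorm (R : realType) (n : nat) (A : 'M[R]_n) : R :=
  sup [set normn (A *m x) / normn x | x in [set x : 'cV[R]_n | x != 0]].

Definition immx (R : realType) (n : nat) (A : 'M[R]_n) : {vspace 'cV[R]_n} :=
  limg (linfun (mulmx A : 'cV[R]_n -> 'cV[R]_n)).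

Definition is_orthoproj (R : realType) (n : nat) (V : {vspace 'cV[R]_n})
    (Q : 'M[R]_n) : Prop :=
  forall x : 'cV[R]_n, Q *m x \in V /\
    (forall y : 'cV[R]_n, y \in V ->
       \sum_(i < n) (x - Q *m x) i 0 * y i 0 = 0).

(* The value is +oo when infinitely many indices have dimension d. *)
Definition ndim (R : realType) (n : nat) (M : countType)
    (S : M -> {vspace 'cV[R]_n}) (d : nat) : \bar R :=
  counting [set m | \dim (S m) = d].

Definition mutually_independent (d : measure_display) (T : measurableType d)
    (R : realType) (P : probability T R) (I : finType) (X : I -> {RV P >-> R})
    : Prop :=
  forall (J : {set I}) (B : I -> set R), (forall i, measurable (B i)) ->
    P (\bigcap_(i in [set` J]) (X i @^-1` B i)) =
    (\prod_(i in J) P (X i @^-1` B i))%E.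

Definition identically_distributed (d : measure_display)
    (T : measurableType d) (R : realType) (P : probability T R) (I : finType)
    (X : I -> {RV P >-> R}) : Prop :=
  forall (i j : I) (B : set R), measurable B ->
    P (X i @^-1` B) = P (X j @^-1` B).

Definition observation (R : realType) (n : nat) (Pn : 'M[R]_n) (s : 'cV[R]_n)
    (sigma : R) (T : Type) (eps : 'I_n -> T -> R) (w : T) : 'cV[R]_n :=
  s + sigma *: (Pn *m \col_(i < n) eps i w).

Definition trproj (R : realType) (n : nat) (Pn Q : 'M[R]_n) : R :=
  \tr (Pn^T *m Q *m Pn).

(* An arbitrary selection among the minimizers, at every outcome.  It is not
   required to be measurable; for the nonnegative loss, the integral is then
   the supremum of the integrals of the simple functions below it. *)
Definition is_selection (R : realType) (n : nat) (M : countType)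
    (pi_ : M -> 'M[R]_n) (pen : M -> R) (T : Type) (Y : T -> 'cV[R]_n)
    (mhat : T -> M) : Prop :=
  forall (w : T) (m : M),
    normn (Y w - pi_ (mhat w) *m Y w) ^+ 2 + pen (mhat w)
    <= normn (Y w - pi_ m *m Y w) ^+ 2 + pen m.

(* Main.v *)
(* The selection inequality reduces the risk to the positive parts of the excesses
   G_m = (1+eta)|pi_m P eps|^2 + 2<u_m, P eps>^2 - (1+theta+L) Tr(P' pi_m P), where
   u_m is the normalised bias and eta is small, and it remains to sum their
   expectations over m.  In units where rho(P) = 1, the key is the tail bound
   P(|W eps|^2 > z) <= C tau (1 + T) z^(delta - p/2) for a contraction W with
   T = |W|_HS^2 and z >= (1+eta) T.  The noise is truncated at the scale
   z^(1/2 - 2 delta) and rounded to a finite grid, and E exp(lam x' Q_k x) is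
   followed along the partial sums x = sum_(i < k) eps_i v_i of the columns of W.
   The matrices Q_k = (1 - gam sum_(i >= k) v_i v_i')^-1 solve a Riccati recursion
   that absorbs the second-order terms of each step and stay below (1 - gam)^-1,
   because the v_i form a frame of norm at most 1.  A partial sum with |x|^2 > z
   needs no control, since the claimed bound is then at least 1; so no decoupling
   or maximal inequality is required.  The loss z^delta is paid for by omega. *)
Require Import Defs.
From mathcomp Require Import all_boot all_order all_algebra finmap.
From mathcomp Require Import all_classical all_reals all_analysis.
From mathcomp Require Import measurable_realfun.
From mathcomp Require Import ring lra.

Set Implicit Arguments.
Unset Strict Implicit.
Unset Printing Implicit Defensive.

Import Order.TTheory GRing.Theory Num.Theory.
Import numFieldNormedType.Exports.

Local Open Scope classical_set_scope.
Local Open Scope ring_scope.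

(** * Euclidean geometry and the Riccati recursion *)

(** The noise need not have exponential moments, and the tail of a quadratic form is governed by a
    single large coordinate: P(eps_i^2 |v_i|^2 > z) <= tau |v_i|^2 z^(-p/2), because |v_i| <= 1.
    Summed over i this is the T of the factor 1 + T; the 1 comes from the exponential bound for the
    truncated noise. Rounding to a grid turns the expectations along the partial sums into iterated
    finite sums, so independence enters only through products of probabilities of events. The cross
    term is the square of a linear form, a quadratic form of rank one, and falls under the same tail
    bound with T <= 1. Integrated beyond (1 + L) T, the tail costs a model of dimension k about (1 +
    L)^(1 + delta - p/2) k^(2 + delta - p/2). Against N_k <= A (1 + k)^(p/2 - 3 - omega) this leaves
    k^(-1 - omega + delta), summable for delta < omega. The factor A (1 + L)^(1 - p/2) is bounded
    since L >= omega' A^(2/(p-2)), and the remaining (1 + L)^delta is absorbed by max(L, 1). *)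

Definition dot {R : realType} {N : nat} (x y : 'cV[R]_N) : R :=
  \sum_i x i 0 * y i 0.

Section DotProduct.
Context {R : realType} {N : nat}.
Implicit Types x y z : 'cV[R]_N.

Lemma dotC x y : dot x y = dot y x.
Proof. by apply: eq_bigr => i _; rewrite mulrC. Qed.

Lemma dotDl x y z : dot (x + y) z = dot x z + dot y z.
Proof. by rewrite -big_split; apply: eq_bigr => i _ /=; rewrite mxE mulrDl. Qed.

Lemma dotDr x y z : dot x (y + z) = dot x y + dot x z.
Proof. by rewrite dotC dotDl !(dotC x). Qed.

Lemma dotZl a x y : dot (a *: x) y = a * dot x y.
Proof. by rewrite big_distrr; apply: eq_bigr => i _ /=; rewrite mxE mulrA. Qed.

Lemma dotZr a x y : dot x (a *: y) = a * dot x y.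
Proof. by rewrite dotC dotZl dotC. Qed.

Lemma dotNl x y : dot (- x) y = - dot x y.
Proof. by rewrite -scaleN1r dotZl mulN1r. Qed.

Lemma dotNr x y : dot x (- y) = - dot x y.
Proof. by rewrite dotC dotNl dotC. Qed.

Lemma dotBl x y z : dot (x - y) z = dot x z - dot y z.
Proof. by rewrite dotDl dotNl. Qed.

Lemma dotBr x y z : dot x (y - z) = dot x y - dot x z.
Proof. by rewrite dotDr dotNr. Qed.

Lemma dot0l x : dot 0 x = 0.
Proof. by rewrite -(scale0r x) dotZl mul0r. Qed.

Lemma dot0r x : dot x 0 = 0.
Proof. by rewrite dotC dot0l. Qed.

Lemma dot_suml (I : Type) (r : seq I) (P : pred I) (F : I -> 'cV[R]_N) x :
  dot (\sum_(i <- r | P i) F i) x = \sum_(i <- r | P i) dot (F i) x.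
Proof.
elim/big_rec2: _ => [|i a b _ <-]; first by rewrite dot0l.
by rewrite dotDl.
Qed.

Lemma dot_ge0 x : 0 <= dot x x.
Proof. by apply: sumr_ge0 => i _; rewrite -expr2 sqr_ge0. Qed.

Lemma dot_eq0 x : dot x x = 0 -> x = 0.
Proof.
move=> /psumr_eq0P x0; apply/colP => i; rewrite mxE; apply/eqP.
by rewrite -sqrf_eq0 expr2 x0 // => j _; rewrite -expr2 sqr_ge0.
Qed.

Lemma cauchy_schwarz x y : dot x y ^+ 2 <= dot x x * dot y y.
Proof.
have [->|y0] := eqVneq y 0; first by rewrite !dot0r expr0n mulr0.
have yy : 0 < dot y y.
  by rewrite lt0r dot_ge0 andbT; apply: contra_neq y0 => /dot_eq0.
have := dot_ge0 (dot y y *: x - dot x y *: y).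
rewrite dotBl !dotBr !dotZl !dotZr (dotC y x) => h.
rewrite -subr_ge0 -(pmulr_rge0 _ yy) (le_trans h) // le_eqVlt.
by apply/orP; left; apply/eqP; ring.
Qed.

End DotProduct.

Lemma dot_mulmx {R : realType} {m n : nat} (A : 'M[R]_(m, n)) x y :
  dot (A *m x) y = dot x (A^T *m y).
Proof.
rewrite /dot.
under eq_bigr do rewrite mxE mulr_suml.
rewrite exchange_big; apply: eq_bigr => j _ /=; rewrite mxE mulr_sumr.
by apply: eq_bigr => i _; rewrite mxE; ring.
Qed.

Section RiccatiMatrix.
Context {R : realType} {N : nat} (I : Type) (v : I -> 'cV[R]_N) (gam : R).
Implicit Types (l : seq I) (x y : 'cV[R]_N).
Hypotheses (gam0 : 0 <= gam) (gam1 : gam <= 2^-1).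

Lemma gam_lt1 : 0 < 1 - gam.
Proof. by move: gam1; lra. Qed.

(** The list [l] holds the columns not yet added to the partial sum, so one step of the walk passes
    from [i :: l] to [l]. *)
Definition riccati_inv l : 'M[R]_N :=
  1%:M - gam *: \sum_(i <- l) v i *m (v i)^T.

Definition riccati l : 'M[R]_N := invmx (riccati_inv l).

(** Bessel bound: it puts the spectrum of [riccati_inv l] in [1 - gam, 1]. *)
Definition frame_le1 l := forall x, \sum_(i <- l) dot (v i) x ^+ 2 <= dot x x.

Lemma mul_outer x y : (y *m y^T) *m x = dot y x *: y.
Proof.
rewrite -mulmxA; apply/colP => i; rewrite !mxE big_ord1 !mxE mulrC.
by congr (_ * _); apply: eq_bigr => j _; rewrite mxE.
Qed.

Lemma riccati_invE l x :
  riccati_inv l *m x = x - gam *: \sum_(i <- l) dot (v i) x *: v i.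
Proof.
rewrite mulmxBl mul1mx -scalemxAl mulmx_suml.
by under eq_bigr do rewrite mul_outer.
Qed.

Lemma riccati_inv_tr l : (riccati_inv l)^T = riccati_inv l.
Proof.
rewrite /riccati_inv linearB /= trmx1 linearZ /= linear_sum /=; congr (_ - _ *: _).
by apply: eq_bigr => i _; rewrite trmx_mul trmxK.
Qed.

Lemma dot_riccati_inv l x :
  dot (riccati_inv l *m x) x = dot x x - gam * \sum_(i <- l) dot (v i) x ^+ 2.
Proof.
rewrite riccati_invE dotBl dotZl dot_suml.
by under eq_bigr do rewrite dotZl -expr2.
Qed.

Lemma riccati_inv_ge l x : frame_le1 l ->
  (1 - gam) * dot x x <= dot (riccati_inv l *m x) x.
Proof.
move=> /(_ x) fl; rewrite dot_riccati_inv mulrBl mul1r lerD2l lerN2.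
exact: ler_wpM2l.
Qed.

(** A coercive matrix has trivial kernel; [kermx] is the left kernel, and symmetry turns its rows
    into column vectors killed by the matrix. *)
Lemma riccati_inv_unit l : frame_le1 l -> riccati_inv l \in unitmx.
Proof.
move=> fl; rewrite -row_free_unit -kermx_eq0; apply/eqP/row_matrixP => i.
set u := row i _; rewrite row0; apply: trmx_inj; rewrite trmx0; apply: dot_eq0.
have Mu : riccati_inv l *m u^T = 0.
  by rewrite -riccati_inv_tr -trmx_mul -row_mul mulmx_ker row0 trmx0.
have := riccati_inv_ge u^T fl; rewrite Mu dot0l => h.
have g1 := gam_lt1.
by apply/eqP; rewrite eq_le dot_ge0 andbT -(pmulr_rle0 _ g1).
Qed.

Lemma riccatiK l x : frame_le1 l -> riccati_inv l *m (riccati l *m x) = x.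
Proof. by move=> fl; rewrite mulmxA mulmxV ?mul1mx ?riccati_inv_unit. Qed.

Lemma riccati_invK l x : frame_le1 l -> riccati l *m (riccati_inv l *m x) = x.
Proof. by move=> fl; rewrite mulmxA mulVmx ?mul1mx ?riccati_inv_unit. Qed.

Lemma riccati_sym l x y : dot (riccati l *m x) y = dot x (riccati l *m y).
Proof. by rewrite dot_mulmx trmx_inv riccati_inv_tr. Qed.

Lemma riccati_norm l x : frame_le1 l ->
  (1 - gam) * dot (riccati l *m x) (riccati l *m x) <= dot (riccati l *m x) x.
Proof.
move=> fl; have := riccati_inv_ge (riccati l *m x) fl.
by rewrite riccatiK // (dotC x).
Qed.

(** With Q for [riccati l], Cauchy-Schwarz and [riccati_norm] give <Qx,x>^2 <= |Qx|^2 |x|^2 <=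
    <Qx,x> |x|^2 / (1 - gam); divide by <Qx,x>. *)
Lemma riccati_le l x : frame_le1 l ->
  (1 - gam) * dot (riccati l *m x) x <= dot x x.
Proof.
move=> fl; have h1 := riccati_norm x fl; have h2 := cauchy_schwarz (riccati l *m x) x.
move: h1 h2; set a := dot (_ *m _) (_ *m _); set q := dot _ x; set r := dot x x.
move=> h1 h2; have a0 : 0 <= a by exact: dot_ge0.
have g1 := gam_lt1.
have q0 : 0 <= q by rewrite (le_trans _ h1) // mulr_ge0 // ltW.
have [q0'|qn] := eqVneq q 0; first by rewrite q0' mulr0 dot_ge0.
have qp : 0 < q by rewrite lt_neqAle eq_sym qn.
rewrite -(ler_pM2r qp) -mulrA -expr2 (le_trans (ler_wpM2l (ltW g1) h2)) //.
by rewrite mulrA mulrC ler_wpM2l // dot_ge0.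
Qed.

Lemma frame_le1_cons i l : frame_le1 (i :: l) -> frame_le1 l.
Proof.
move=> fl x; apply: le_trans (fl x); rewrite big_cons lerDr; exact: sqr_ge0.
Qed.

(** The frame bound at [v i] itself gives |v_i|^4 <= |v_i|^2. *)
Lemma frame_le1_vec i l : frame_le1 (i :: l) -> dot (v i) (v i) <= 1.
Proof.
move=> /(_ (v i)); rewrite big_cons => h.
have {}h : dot (v i) (v i) ^+ 2 <= dot (v i) (v i).
  by apply: le_trans h; rewrite lerDl sumr_ge0 // => j _; rewrite sqr_ge0.
have := dot_ge0 (v i); rewrite le_eqVlt => /predU1P[<-//|v0].
by move: h; rewrite expr2 ger_pMr.
Qed.

(* The inverses differ by a rank-one matrix, so with [u := riccati (i :: l) *m x]
   the gap between the two sides is a multiple of [dot (v i) u ^+ 2]. *)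
Lemma riccati_cons i l x : frame_le1 (i :: l) ->
  dot (riccati l *m x) x + gam * dot (riccati l *m x) (v i) ^+ 2
  <= dot (riccati (i :: l) *m x) x.
Proof.
move=> fil; have fl := frame_le1_cons fil.
set u := riccati (i :: l) *m x.
have xE : x = riccati_inv l *m u - (gam * dot (v i) u) *: v i.
  rewrite -[LHS](riccatiK _ fil) -/u !riccati_invE big_cons scalerDr scalerA opprD.
  by rewrite addrA addrAC.
have QxE : riccati l *m x = u - (gam * dot (v i) u) *: (riccati l *m v i).
  by rewrite {1}xE mulmxBr riccati_invK // -scalemxAr.
(* With h = <Q v_i, v_i> and t = <v_i, u> the gap will be gam t^2 (1 - gam h) gam h, so 0 <= gam h
   <= 1 is needed. Here h <= |v_i|^2 / (1 - gam) <= 2, as gam <= 1/2. *)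
have hle : gam * dot (riccati l *m v i) (v i) <= 1.
  have h := riccati_le (v i) fl; have h' := frame_le1_vec fil.
  have h2 : dot (riccati l *m v i) (v i) <= 2.
    have : 2^-1 * dot (riccati l *m v i) (v i) <= 1.
      apply: le_trans (le_trans h h'); rewrite ler_wpM2r //; last by move: gam1; lra.
      by apply: le_trans (riccati_norm _ fl); rewrite mulr_ge0 ?dot_ge0// ltW// gam_lt1.
    by rewrite mulrC ler_pdivrMr // mul1r.
  by rewrite (le_trans (ler_wpM2l gam0 h2)) // -ler_pdivlMr // mul1r.
have h0 : 0 <= gam * dot (riccati l *m v i) (v i).
  by rewrite mulr_ge0 // (le_trans _ (riccati_norm _ fl)) // mulr_ge0 ?dot_ge0// ltW// gam_lt1.
move: hle h0; set h := dot (riccati l *m v i) (v i) => hle h0.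
move: xE QxE; set t := dot (v i) u => xE QxE.
have e1 : dot (riccati l *m x) (v i) = t - gam * t * h.
  by rewrite QxE dotBl dotZl -/h /t (dotC u).
have e2 : dot (riccati l *m x) x = dot u x - gam * t * (t - gam * t * h).
  rewrite {1}QxE dotBl dotZl; congr (_ - _ * _).
  by rewrite riccati_sym dotC e1.
rewrite e1 e2.
rewrite -subr_ge0.
have -> : dot u x - (dot u x - gam * t * (t - gam * t * h)
    + gam * (t - gam * t * h) ^+ 2) = gam * t ^+ 2 * ((1 - gam * h) * (gam * h)).
  by ring.
have h1 : 0 <= 1 - gam * h by rewrite subr_ge0.
by rewrite (mulr_ge0 (mulr_ge0 gam0 (sqr_ge0 t)) (mulr_ge0 h1 h0)).
Qed.

(** The forms increase as columns are added to [l], starting from the identity at the empty list. *)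
Lemma riccati_ge l x : frame_le1 l -> dot x x <= dot (riccati l *m x) x.
Proof.
elim: l => [|i l IH] fl.
  by rewrite /riccati /riccati_inv big_nil scaler0 subr0 invmx1 mul1mx.
apply: le_trans (IH (frame_le1_cons fl)) _.
by apply: le_trans (riccati_cons x fl); rewrite lerDl mulr_ge0 ?sqr_ge0.
Qed.

End RiccatiMatrix.

(** * Exponential bound for discrete noise *)

(** From e^(-z) >= 1 - z one gets e^z <= 1 / (1 - z), and the right side exceeds this by z^2 (1 - 2
    z) / (1 - z). *)
Lemma expR_le_quadratic {R : realType} (z : R) : z <= 2^-1 ->
  expR z <= 1 + z + 2 * z ^+ 2.
Proof.
move=> z1; have zp : 0 < 1 - z by move: z1; lra.
have e1 : 1 - z <= expR (- z) by apply: expR_ge1Dx.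
have : expR z <= (1 - z)^-1 by rewrite -[z]opprK expRN lef_pV2 ?posrE ?expR_gt0 ?opprK.
move=> /le_trans; apply; rewrite -[X in X <= _]mul1r ler_pdivrMr//.
rewrite -subr_ge0.
have -> : (1 + z + 2 * z ^+ 2) * (1 - z) - 1 = z ^+ 2 * (1 - 2 * z) by ring.
by rewrite mulr_ge0 ?sqr_ge0//; move: z1; lra.
Qed.

Section TailRecursion.
Context {R : realType} {N : nat} (I : Type) (A : finType).
Variables (v : I -> 'cV[R]_N) (w x : I -> A -> R) (m : I -> R).
Variables (b lam al y : R).
Hypotheses (w0 : forall i a, 0 <= w i a) (w1 : forall i, \sum_a w i a = 1).
Hypotheses (xb : forall i a, x i a ^+ 2 * dot (v i) (v i) <= b ^+ 2).
Hypotheses (x2 : forall i, \sum_a w i a * x i a ^+ 2 <= 1).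
Hypotheses (xm : forall i, `|\sum_a w i a * x i a| <= m i).
Hypotheses (b0 : 0 <= b) (lam0 : 0 < lam) (al0 : 0 < al).
Hypotheses (gam1 : al + 16 * lam <= 2^-1).
Hypotheses (y0 : 0 <= y) (small : lam * (4 * b * Num.sqrt y + 2 * b ^+ 2) <= 2^-1).

(** Each part of [gam] pays for one source of terms in <Q S, v_i>^2: [al] for the nonzero mean of
    the truncated noise, [16 * lam] for the quadratic term in the expansion of the exponential. *)
Let gam := al + 16 * lam.

(** The probability that the walk started at [S] with remaining steps [l] ends with squared norm
    above [y], computed by conditioning on one coordinate at a time. *)
Fixpoint tailprob (l : seq I) (S : 'cV[R]_N) : R :=
  if l is i :: l' then \sum_a w i a * tailprob l' (S + x i a *: v i)
  else (y < dot S S)%R%:R.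

Lemma tailprob_le1 l S : tailprob l S <= 1.
Proof.
elim: l S => [|i l IH] S /=; first by case: (_ < _).
rewrite -(w1 i); apply: ler_sum => a _.
by rewrite -[X in _ <= X]mulr1 ler_wpM2l.
Qed.

Lemma tailprob_ge0 l S : 0 <= tailprob l S.
Proof.
elim: l S => [|i l IH] S /=; first by case: (_ < _).
by apply: sumr_ge0 => a _; rewrite mulr_ge0.
Qed.

(** One step of the exponential moment: [be] and [h] stand for <Q S, v_i> and <Q v_i, v_i>, so the
    exponent on the left is the form of Q at S + x v_i. The term [gam * be ^+ 2] on the right is
    exactly what [riccati_cons] can absorb. *)
Lemma step_le i (be h S2 : R) : 0 <= h -> h <= 2 * dot (v i) (v i) ->
  be ^+ 2 <= 4 * y * dot (v i) (v i) ->
  \sum_a w i a * expR (lam * (S2 + 2 * x i a * be + x i a ^+ 2 * h))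
  <= expR (lam * (S2 + gam * be ^+ 2 + h * (1 + 8 * lam * b ^+ 2) + m i ^+ 2 / al)).
Proof.
move=> h0 hv bev.
have xbe a : x i a * be <= 2 * b * Num.sqrt y.
  rewrite (le_trans (ler_norm _))// -ler_sqr ?nnegrE ?mulr_ge0 ?sqrtr_ge0//.
  rewrite real_normK ?num_real// !exprMn sqr_sqrtr//.
  apply: (@le_trans _ _ (x i a ^+ 2 * (4 * y * dot (v i) (v i)))).
    by rewrite ler_wpM2l ?sqr_ge0.
  have := ler_wpM2l y0 (xb i a); nra.
have xh a : x i a ^+ 2 * h <= 2 * b ^+ 2.
  apply: (@le_trans _ _ (x i a ^+ 2 * (2 * dot (v i) (v i)))).
    by rewrite ler_wpM2l ?sqr_ge0.
  by have := xb i a; nra.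
pose z a := lam * (2 * x i a * be + x i a ^+ 2 * h).
have z1 a : z a <= 2^-1.
  apply: le_trans small; rewrite /z (ler_wpM2l (ltW lam0))// lerD//.
  by have := xbe a; lra.
(* Here (a + b)^2 <= 2 a^2 + 2 b^2, and one factor x^2 h of the last square is replaced by its bound
   2 b^2, so that only second moments of the noise remain. *)
have z2 a : z a ^+ 2 <= 8 * lam ^+ 2 * be ^+ 2 * x i a ^+ 2
    + 4 * lam ^+ 2 * b ^+ 2 * h * x i a ^+ 2.
  have e : z a ^+ 2 <= 2 * (lam ^+ 2 * (4 * x i a ^+ 2 * be ^+ 2 + x i a ^+ 2 * h * (x i a ^+ 2 * h))).
    rewrite -subr_ge0.
    have -> : 2 * (lam ^+ 2 * (4 * x i a ^+ 2 * be ^+ 2 +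
        x i a ^+ 2 * h * (x i a ^+ 2 * h))) - z a ^+ 2
        = (lam * (2 * x i a * be - x i a ^+ 2 * h)) ^+ 2 by rewrite /z; ring.
    exact: sqr_ge0.
  apply: le_trans e _.
  have xh0 : 0 <= x i a ^+ 2 * h by rewrite mulr_ge0 ?sqr_ge0.
  have := ler_wpM2l (sqr_ge0 lam) (ler_wpM2l xh0 (xh a)).
  set X := x i a ^+ 2; set B := b ^+ 2; set L := lam ^+ 2; set E := be ^+ 2.
  by nra.
have wz a : w i a * expR (z a) <= w i a + lam * (2 * be) * (w i a * x i a)
    + (lam * h + 16 * lam ^+ 2 * be ^+ 2 + 8 * lam ^+ 2 * b ^+ 2 * h)
      * (w i a * x i a ^+ 2).
  apply: (@le_trans _ _ (w i a * (1 + z a + 2 * (8 * lam ^+ 2 * be ^+ 2 * x i a ^+ 2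
    + 4 * lam ^+ 2 * b ^+ 2 * h * x i a ^+ 2)))).
    rewrite ler_wpM2l//; apply: le_trans (expR_le_quadratic (z1 a)) _.
    by rewrite lerD2l ler_wpM2l.
  by rewrite /z le_eqVlt; apply/orP; left; apply/eqP; ring.
have -> : \sum_a w i a * expR (lam * (S2 + 2 * x i a * be + x i a ^+ 2 * h))
    = expR (lam * S2) * \sum_a w i a * expR (z a).
  rewrite mulr_sumr; apply: eq_bigr => a _.
  by rewrite mulrCA -expRD; congr (_ * expR _); rewrite /z; ring.
have -> : expR (lam * (S2 + gam * be ^+ 2 + h * (1 + 8 * lam * b ^+ 2) + m i ^+ 2 / al))
   = expR (lam * S2) * expR (lam * (gam * be ^+ 2 + h * (1 + 8 * lam * b ^+ 2) + m i ^+ 2 / al)).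
  by rewrite -expRD; congr expR; ring.
rewrite ler_wpM2l ?expR_ge0//; apply: le_trans (expR_ge1Dx _).
apply: le_trans; first by apply: ler_sum => a _; exact: wz.
rewrite !big_split /= w1 -!mulr_sumr -addrA lerD2l.
set mu := \sum_a _ * x i a; set s2 := \sum_a w i a * x i a ^+ 2.
set K := lam * h + _ + _.
have K0 : 0 <= K.
  have l2 := sqr_ge0 lam; have l0 := ltW lam0; have be2 := sqr_ge0 be.
  have b2 := sqr_ge0 b.
  apply: addr_ge0; [apply: addr_ge0; first exact: mulr_ge0|].
    by apply: mulr_ge0 => //; exact: mulr_ge0.
  by apply: mulr_ge0 => //; apply: mulr_ge0 => //; exact: mulr_ge0.
have Ks : K * s2 <= K by rewrite -[X in _ <= X]mulr1 ler_wpM2l// x2.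
(* Young's inequality: the drift due to the mean becomes a part of [gam * be ^+ 2] plus a
   constant. *)
have mub : 2 * be * mu <= al * be ^+ 2 + m i ^+ 2 / al.
  have m2 : mu ^+ 2 <= m i ^+ 2.
    by rewrite -real_normK ?num_real// ler_sqr ?nnegrE ?xm// (le_trans _ (xm i)).
  apply: (@le_trans _ _ (al * be ^+ 2 + mu ^+ 2 / al)); last first.
    by rewrite lerD2l ler_wpM2r// invr_ge0 ltW.
  rewrite -subr_ge0.
  have -> : al * be ^+ 2 + mu ^+ 2 / al - 2 * be * mu = al * (be - mu / al) ^+ 2.
    by field; rewrite gt_eqF.
  by rewrite mulr_ge0 ?sqr_ge0// ltW.
rewrite -(mulrA lam (2 * be)).
apply: le_trans (lerD (ler_wpM2l (ltW lam0) mub) Ks) _.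
  rewrite le_eqVlt; apply/orP; left; apply/eqP; rewrite /K /gam; field.
  by rewrite gt_eqF.
Qed.

(** Since gam <= 1/2, |QS|^2 <= 2 <QS,S> <= 4 |S|^2; then Cauchy-Schwarz. This is the bound on [be]
    required by [step_le]. *)
Lemma frame_half i l : frame_le1 v (i :: l) -> forall S, dot S S <= y ->
  dot (riccati v gam l *m S) (v i) ^+ 2 <= 4 * y * dot (v i) (v i).
Proof.
move=> fil S Sy; have fl := frame_le1_cons fil.
have g0 : 0 <= gam by rewrite /gam addr_ge0// ?mulr_ge0// ltW.
apply: le_trans (cauchy_schwarz _ _) _; rewrite ler_wpM2r ?dot_ge0//.
have := riccati_le g0 gam1 S fl; have := riccati_norm g0 gam1 S fl.
move: gam1; rewrite -/gam; set q := dot (_ *m _) S; set r := dot (_ *m _) _ => g1 h1 h2.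
have q2 : 2^-1 * q <= y.
  apply: le_trans (le_trans h2 Sy); rewrite ler_wpM2r//.
    by rewrite /q; apply: le_trans h1; rewrite mulr_ge0 ?dot_ge0//; move: g1; lra.
  by move: g1; lra.
have r2 : 2^-1 * r <= q.
  by apply: le_trans h1; rewrite ler_wpM2r ?dot_ge0//; move: g1; lra.
by move: q2 r2; lra.
Qed.

(** The right side is a supermartingale along the walk as long as |S|^2 <= y. The summand for [i]
    bounds the drift of one step, using <Q v_i, v_i> <= |v_i|^2 / (1 - gam). *)
Lemma tailprob_le l S : frame_le1 v l ->
  tailprob l S <= expR (lam * (dot (riccati v gam l *m S) S
    + \sum_(i <- l) (dot (v i) (v i) * ((1 + 8 * lam * b ^+ 2) / (1 - gam))
                      + m i ^+ 2 / al) - y)).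
Proof.
have g0 : 0 <= gam by rewrite /gam addr_ge0// ?mulr_ge0// ltW.
have g1 : 0 < 1 - gam by move: gam1; rewrite -/gam; lra.
have k0 : 0 <= 1 + 8 * lam * b ^+ 2.
  by rewrite addr_ge0// mulr_ge0 ?sqr_ge0// mulr_ge0// ltW.
pose c i := dot (v i) (v i) * ((1 + 8 * lam * b ^+ 2) / (1 - gam)) + m i ^+ 2 / al.
have c0 i : 0 <= c i.
  rewrite addr_ge0// ?divr_ge0 ?sqr_ge0 ?(ltW al0)//.
  by rewrite mulr_ge0 ?dot_ge0// divr_ge0// ltW.
elim: l S => [|i l IH] S fl.
  rewrite big_nil addr0 /=; case: ltP => [h|_]; last exact: expR_ge0.
  apply: le_trans (expR_ge1Dx _); rewrite lerDl mulr_ge0 ?(ltW lam0)// subr_ge0.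
  by apply: le_trans (ltW h) _; exact: riccati_ge.
have [yS|Sy] := ltP y (dot S S).
  apply: le_trans (tailprob_le1 _ _) _.
  apply: le_trans (expR_ge1Dx _); rewrite lerDl mulr_ge0 ?(ltW lam0)//.
  rewrite addrAC addr_ge0//; last by apply: sumr_ge0 => j _; exact: c0.
  rewrite subr_ge0.
  by apply: le_trans (ltW yS) _; exact: riccati_ge.
have fl' := frame_le1_cons fl.
rewrite /= big_cons.
pose Sl := \sum_(j <- l) c j.
set be := dot (riccati v gam l *m S) (v i).
set h := dot (riccati v gam l *m v i) (v i).
have h0 : 0 <= h.
  by rewrite /h; apply: le_trans (riccati_norm g0 gam1 (v i) fl'); rewrite mulr_ge0 ?dot_ge0// ltW.
have hv1 := riccati_le g0 gam1 (v i) fl'.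
have hv : h <= 2 * dot (v i) (v i).
  have : 2^-1 * h <= dot (v i) (v i).
    by apply: le_trans hv1; rewrite ler_wpM2r//; move: gam1; rewrite -/gam; lra.
  by lra.
have hb := frame_half fl Sy.
have := step_le (i := i) (be := be) (h := h) (dot (riccati v gam l *m S) S + Sl - y) h0 hv hb.
have -> : \sum_a w i a * expR (lam * (dot (riccati v gam l *m S) S + Sl - y + 2 * x i a * be + x i a ^+ 2 * h))
   = \sum_a w i a * expR (lam * (dot (riccati v gam l *m (S + x i a *: v i)) (S + x i a *: v i) + Sl - y)).
  apply: eq_bigr => a _; congr (_ * expR (_ * _)).
  rewrite mulmxDr -scalemxAr !dotDl !dotDr !dotZl !dotZr -/h -/be.
  have -> : dot (riccati v gam l *m v i) S = be by rewrite riccati_sym dotC.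
  by ring.
move=> step; apply: (@le_trans _ _ (\sum_a w i a *
    expR (lam * (dot (riccati v gam l *m (S + x i a *: v i)) (S + x i a *: v i) + Sl - y)))).
  by apply: ler_sum => a _; rewrite ler_wpM2l//; exact: IH.
apply: le_trans step _; rewrite ler_expR ler_wpM2l ?(ltW lam0)//.
have hc : h * (1 + 8 * lam * b ^+ 2) + m i ^+ 2 / al <= c i.
  rewrite lerD2r mulrA (mulrAC _ _ (1 - gam)^-1) ler_wpM2r//.
  by rewrite ler_pdivlMr// mulrC.
have := riccati_cons g0 gam1 S fl.
rewrite -/be -[X in _ -> _ <= _ + (X + _) - _]/(c i) -/Sl; move: hc.
by lra.
Qed.

End TailRecursion.

(** * Independent finite-valued noise *)

Lemma integral_cst_prob d (T : measurableType d) (R : realType)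
  (P : probability T R) (r : R) : (\int[P]_t r%:E = r%:E)%E.
Proof. by have := expectation_cst P r; rewrite unlock. Qed.

Lemma measurable_gt d (T : measurableType d) (R : realType) (f : T -> R) (c : R) :
  measurable_fun setT f -> measurable [set t | c < f t].
Proof.
move=> mf; rewrite (_ : mkset _ = setT `&` (fun t => c < f t) @^-1` [set true]).
  by apply: measurable_fun_ltr.
by rewrite setTI; apply/seteqP; split.
Qed.

Section FiniteValued.
Context {d : measure_display} {T : measurableType d} {R : realType}.
Variables (P : probability T R) (A : finType) (g : T -> A).
Hypothesis mg : forall a, measurable (g @^-1` [set a]).

Lemma sum_indic_fiber (f : A -> R) t :
  f (g t) = \sum_a f a * \1_(g @^-1` [set a]) t.
Proof.
rewrite (bigD1 (g t))//= big1 ?addr0; last first.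
  by move=> a /eqP ag; rewrite indicE memNset ?mulr0// => h; apply: ag.
by rewrite indicE mem_set// mulr1.
Qed.

Lemma sum_indic_fiberE (f : A -> R) t :
  ((f (g t))%:E = \sum_a (f a)%:E * (\1_(g @^-1` [set a]) t)%:E)%E.
Proof. by rewrite sum_indic_fiber -sumEFin. Qed.

Lemma integrable_finval (f : A -> R) :
  P.-integrable setT (EFin \o (f \o g)).
Proof.
have -> : EFin \o (f \o g) =
    (fun t => \sum_a (f a)%:E * (\1_(g @^-1` [set a]) t)%:E)%E.
  by apply/funext => t /=; rewrite sum_indic_fiberE.
apply: integrable_sum => // a _; apply: integrableZl => //.
exact: integrable_indic.
Qed.

Lemma integral_finval (f : A -> R) :
  (\int[P]_t (f (g t))%:E = (\sum_a fine (P (g @^-1` [set a])) * f a)%:E)%E.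
Proof.
under eq_integral => t _ do rewrite sum_indic_fiberE.
rewrite integral_sum//; last first.
  by move=> a; apply: integrableZl => //; exact: integrable_indic.
rewrite -sumEFin; apply: eq_bigr => a _.
rewrite integralZl//; last exact: integrable_indic.
by rewrite integral_indic// setIT EFinM fineK ?fin_num_measure// muleC.
Qed.

Lemma prob_split (E : set T) : measurable E ->
  P E = (\sum_a P (E `&` g @^-1` [set a]))%E.
Proof.
move=> mE; rewrite -[E in LHS]setTI -integral_indic//.
have -> : (\int[P]_(x in E) (\1_setT x)%:E =
    \int[P]_(x in E) \sum_a (\1_(g @^-1` [set a]) x)%:E)%E.
  apply: eq_integral => t _; rewrite indicT/=.
  have := sum_indic_fiberE (cst 1) t; rewrite /= => ->.
  by apply: eq_bigr => a _; rewrite mul1e.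
rewrite integral_sum//; last first.
  by move=> a; apply: integrableS (integrable_indic _ _) => //; exact: measurableT.
by apply: eq_bigr => a _; rewrite integral_indic// setIC.
Qed.

End FiniteValued.

Section IndependentCells.
Context {d : measure_display} {T : measurableType d} {R : realType}.
Variables (P : probability T R) (n N : nat) (A : finType).
Variables (eps : 'I_n -> {RV P >-> R}) (cell : 'I_n -> R -> A).
Variables (x : 'I_n -> A -> R) (v : 'I_n -> 'cV[R]_N) (y : R).
Hypothesis indep : mutually_independent eps.
Hypothesis mcell : forall i a, measurable (cell i @^-1` [set a]).

Definition cell_weight i a := fine (P ((cell i \o eps i) @^-1` [set a])).

Let w := cell_weight.
Let xi i t := x i (cell i (eps i t)).

Let box (B : 'I_n -> set R) : set T := \bigcap_(i in [set` [set: 'I_n]%SET]) (eps i @^-1` B i).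

Let event (l : seq 'I_n) (S : 'cV[R]_N) : set T :=
  [set t | y < dot (S + \sum_(i <- l) xi i t *: v i)
                   (S + \sum_(i <- l) xi i t *: v i)].

Lemma measurable_eps i (B : set R) : measurable B -> measurable (eps i @^-1` B).
Proof. by move=> mB; rewrite -[X in measurable X]setTI; exact: measurable_funP. Qed.

Lemma measurable_cell i a : measurable ((cell i \o eps i) @^-1` [set a]).
Proof. by rewrite comp_preimage; exact: measurable_eps. Qed.

Lemma cell_weight_ge0 i a : 0 <= w i a.
Proof. exact: fine_ge0. Qed.

Lemma sum_cell_weight i : \sum_a w i a = 1.
Proof.
have := integral_finval P (fun a => measurable_cell i a) (cst 1).
rewrite integral_cst_prob => -[->]; by apply: eq_bigr => a _; rewrite mulr1.
Qed.

Let measurable_box B : (forall i, measurable (B i)) -> measurable (box B).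
Proof.
move=> mB; apply: fin_bigcap_measurable => // i _; exact: measurable_eps.
Qed.

Let event_cons i l S a :
  event (i :: l) S `&` (cell i \o eps i) @^-1` [set a]
  = event l (S + x i a *: v i) `&` (cell i \o eps i) @^-1` [set a].
Proof.
apply/seteqP; split=> t [] /= + ca; rewrite /event /= big_cons addrA /xi ca => h; split=> //.
Qed.

Let event_nil S : event [::] S = if y < dot S S then setT else set0.
Proof.
apply/seteqP; split=> t; rewrite /event /= big_nil addr0; first by move=> ->.
by case: (y < dot S S).
Qed.

Let event_measurable l S : measurable (event l S).
Proof.
elim: l S => [|i l IH] S.
  by rewrite event_nil; case: ifP.
rewrite (_ : event _ _ = \big[setU/set0]_(a : A)
    (event (i :: l) S `&` (cell i \o eps i) @^-1` [set a])).
  apply: bigsetU_measurable => a _; rewrite event_cons.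
  by apply: measurableI => //; exact: measurable_cell.
apply/seteqP; split=> t.
  move=> et; rewrite -bigcup_seq; exists (cell i (eps i t)) => //=.
  by rewrite mem_index_enum.
by rewrite -bigcup_seq => -[a _ []].
Qed.

Let box_restrict (B : 'I_n -> set R) i a j :=
  if j == i then cell i @^-1` [set a] else B j.

Let prob_box_restrict B i a : (forall j, measurable (B j)) -> B i = setT ->
  (P (box (box_restrict B i a)) = P (box B) * (w i a)%:E)%E.
Proof.
move=> mB Bi; rewrite /box !indep//; last first.
  by move=> j; rewrite /box_restrict; case: eqP => // ->.
rewrite (bigD1 i) ?inE//= [in RHS](bigD1 i) ?inE//= Bi preimage_setT probability_setT mul1e.
rewrite muleC; congr (_ * _)%E.
  by apply: eq_bigr => j /andP[_ ji]; rewrite /box_restrict (negbTE ji).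
rewrite /box_restrict eqxx.
by rewrite /w /cell_weight fineK// fin_num_measure//; exact: measurable_cell.
Qed.

(** The box carries the conditioning: it leaves the coordinates of [l] free, and fixing the cell of
    coordinate [i] restricts it to a smaller box whose probability gains the factor [w i a] by
    independence. *)
Lemma prob_box_event l S B : uniq l -> (forall i, measurable (B i)) ->
  (forall i, i \in l -> B i = setT) ->
  (P (box B `&` event l S) = P (box B) * (tailprob v w x y l S)%:E)%E.
Proof.
elim: l S B => [|i l IH] S B /=.
  move=> _ mB _; rewrite event_nil; case: ltP => h.
    by rewrite setIT mule1.
  by rewrite setI0 measure0 mule0.
move=> /andP[il ul] mB Bl.
have Bi : B i = setT by apply: Bl; rewrite mem_head.
rewrite (prob_split P (fun a => measurable_cell i a)); last first.
  by apply: measurableI; [exact: measurable_box|exact: event_measurable].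
have t0 a : 0 <= tailprob v w x y l (S + x i a *: v i).
  by apply: tailprob_ge0; exact: cell_weight_ge0.
rewrite -sumEFin ge0_sume_distrr//; last first.
  by move=> a _; rewrite lee_fin mulr_ge0// cell_weight_ge0.
apply: eq_bigr => a _.
rewrite -setIA event_cons setIA setIAC.
have -> : box B `&` (cell i \o eps i) @^-1` [set a] = box (box_restrict B i a).
  apply/seteqP; split=> t.
    move=> [/= bt ca] j _; rewrite /box_restrict /preimage/=.
    by case: eqP => [->//|_]; apply: bt; rewrite /= inE.
  move=> bt; split; last first.
    by have := bt i; rewrite /box_restrict /= eqxx; apply; rewrite inE.
  move=> j _; have := bt j; rewrite /box_restrict /preimage/=.
  by case: eqP => [-> _|_]; [rewrite Bi|apply; rewrite inE].
rewrite IH//.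
- by rewrite prob_box_restrict// EFinM muleA.
- by move=> j; rewrite /box_restrict; case: eqP => // ->.
- move=> j jl; rewrite /box_restrict; case: eqP => [ji|_].
    by move: il; rewrite -ji jl.
  by apply: Bl; rewrite inE jl orbT.
Qed.

Lemma measurable_cell_sum :
  measurable [set t | y < dot (\sum_i x i (cell i (eps i t)) *: v i)
                              (\sum_i x i (cell i (eps i t)) *: v i)].
Proof.
rewrite [X in measurable X](_ : _ = event (enum 'I_n) 0).
  exact: event_measurable.
by apply/seteqP; split => t; rewrite /event /= add0r big_enum.
Qed.

Lemma prob_cell_sum : P [set t | y < dot (\sum_i x i (cell i (eps i t)) *: v i)
                                      (\sum_i x i (cell i (eps i t)) *: v i)]
  = (tailprob v w x y (enum 'I_n) 0)%:E.
Proof.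
have := @prob_box_event (enum 'I_n) 0 (fun=> setT) (enum_uniq _).
rewrite (_ : box _ = setT); last first.
  by apply/seteqP; split=> // t _ i _; rewrite preimage_setT.
rewrite setTI probability_setT mul1e => <- //.
by congr (P _); apply/seteqP; split => t; rewrite /event /= add0r big_enum.
Qed.

End IndependentCells.

(** * Truncation and rounding *)

Section Rounding.
Context {R : realType} (n K : nat).
Variables (q : 'I_n -> R) (b h : R).
Hypotheses (q0 : forall i, 0 <= q i) (b0 : 0 <= b) (h0 : 0 < h).
Hypothesis bK : forall i, 0 < q i -> b / (h * Num.sqrt (q i)) < K.+1%:R.

(** A sign and a number of mesh steps [h]. Rounding is towards 0, so it never increases the absolute
    value, and [bK] makes the grid large enough for every value kept by the truncation. *)
Let grid : finType := (bool * 'I_K.+1)%type.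

(* A column of norm 0 gets the value 0 everywhere, so that the range is finite. *)
Definition trunc_dom i (x : R) : bool := (0 < q i) && (x ^+ 2 * q i <= b ^+ 2).

Definition grid_cell i (x : R) : grid :=
  if trunc_dom i x then (x < 0, inord (Num.truncn (`|x| / h))) else (false, ord0).

(** The truncation test is repeated on the grid value, so that [grid_value_sqr] holds at every point
    of the grid, reached or not. *)
Definition grid_value i (a : grid) : R :=
  if (0 < q i) && ((h * a.2%:R) ^+ 2 * q i <= b ^+ 2)
  then (-1) ^+ a.1 * (h * a.2%:R) else 0.

Lemma grid_value_sqr i a : grid_value i a ^+ 2 * q i <= b ^+ 2.
Proof.
rewrite /grid_value; case: ifP => [/andP[_ h1]|_]; last by rewrite expr0n mul0r sqr_ge0.
by rewrite exprMn sqrr_sign mul1r.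
Qed.

Lemma grid_value0 i a : q i = 0 -> grid_value i a = 0.
Proof. by move=> q0i; rewrite /grid_value q0i ltxx. Qed.

Lemma truncn_le_grid i x : trunc_dom i x -> (Num.truncn (`|x| / h) < K.+1)%N.
Proof.
move=> /andP[qi xb]; rewrite ltnS truncn_le_nat; apply: le_lt_trans (bK qi).
have sq : 0 < Num.sqrt (q i) by rewrite sqrtr_gt0.
rewrite ler_pdivlMr ?mulr_gt0// mulrA divfK ?gt_eqF//.
rewrite -ler_sqr ?nnegrE ?mulr_ge0// ?(ltW sq)//.
by rewrite exprMn real_normK ?num_real// sqr_sqrtr.
Qed.

Lemma grid_value_cell i x : trunc_dom i x ->
  grid_value i (grid_cell i x) = (-1) ^+ (x < 0)%R * (h * (Num.truncn (`|x| / h))%:R)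
  /\ h * (Num.truncn (`|x| / h))%:R <= `|x|.
Proof.
move=> tx; have tK := truncn_le_grid tx; rewrite /grid_value /grid_cell tx /= inordK//.
have hx : h * (Num.truncn (`|x| / h))%:R <= `|x|.
  by rewrite mulrC -ler_pdivlMr// truncn_le divr_ge0// ltW.
split => //; move/andP: tx => [qi xb]; rewrite qi /=; case: ifP => // /negP[].
apply: le_trans xb; rewrite ler_wpM2r// -[in leRHS]real_normK ?num_real//.
by rewrite ler_sqr ?nnegrE// mulr_ge0// ltW.
Qed.

Lemma grid_value_le i x : `|grid_value i (grid_cell i x)| <= `|x|.
Proof.
have [tx|tx] := boolP (trunc_dom i x).
  have [-> hx] := grid_value_cell tx.
  by rewrite normrMsign ger0_norm// mulr_ge0// ltW.
rewrite /grid_value /grid_cell (negbTE tx) /= mulr0 mulr0.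
by case: ifP; rewrite normr0.
Qed.

Lemma grid_value_near i x : trunc_dom i x -> `|x - grid_value i (grid_cell i x)| <= h.
Proof.
move=> tx; have [-> hx] := grid_value_cell tx.
rewrite {1}[x]numEsign -mulrBr normrMsign ger0_norm ?subr_ge0//.
have := ltW (truncnS_gt (`|x| / h)); rewrite ler_pdivrMr// -natr1 mulrDl mul1r.
by rewrite lerBlDr addrC (mulrC h).
Qed.

Lemma grid_value_dist i x : `|x - grid_value i (grid_cell i x)| <= `|x|.
Proof.
have [tx|tx] := boolP (trunc_dom i x); last first.
  rewrite /grid_value /grid_cell (negbTE tx) /= mulr0 mulr0.
  by case: ifP; rewrite subr0.
have [-> hx] := grid_value_cell tx.
rewrite {1}[x]numEsign -mulrBr normrMsign ger0_norm ?subr_ge0//.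
by rewrite lerBlDr lerDl mulr_ge0// ltW.
Qed.

Lemma measurable_grid_cell i a : measurable (grid_cell i @^-1` [set a]).
Proof.
have mx : measurable_fun setT (fun x : R => x) by [].
(* Membership in the cell [a] as a boolean combination of comparisons, the integer part being
   described by an interval. *)
pose f x := (trunc_dom i x && (((x < 0)%R == a.1) &&
    ((a.2%:R <= `|x| / h) && (`|x| / h < a.2.+1%:R))))
  || (~~ trunc_dom i x && (a == (false, ord0))).
have mt : measurable_fun setT (trunc_dom i).
  apply: measurable_and => //; apply: measurable_fun_ler => //.
  by apply: measurable_funM => //; exact: measurable_funX.
have ma : measurable_fun setT (fun x : R => `|x| / h).
  by apply: measurable_funM => //; exact: measurableT_comp.
have mf : measurable_fun setT f.
  apply: measurable_or; apply: measurable_and => //; last exact: measurable_neg.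
  apply: measurable_and; last first.
    by apply: measurable_and; [exact: measurable_fun_ler|exact: measurable_fun_ltr].
  case: (a.1); last first.
    under eq_fun do rewrite eqbF_neg.
    by apply: measurable_neg; exact: measurable_fun_ltr.
  under eq_fun do rewrite eqb_id.
  exact: measurable_fun_ltr.
rewrite (_ : _ @^-1` _ = setT `&` f @^-1` [set true]); first exact: mf.
apply/seteqP; rewrite setTI; split=> x.
  rewrite /f /= => <-; rewrite /grid_cell; case: ifP => //= tx.
  rewrite eqxx inordK ?(truncn_le_grid tx)//= -truncn_eq ?eqxx//.
  by rewrite divr_ge0// ltW.
rewrite /f /= /grid_cell; case: ifP => /= tx; last by move=> /eqP ->.
rewrite orbF => /andP[/eqP-> ta].
by rewrite (truncn_def ta) inord_val -surjective_pairing.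
Qed.

End Rounding.

Section GridMoments.
Context {d : measure_display} {T : measurableType d} {R : realType}.
Variables (P : probability T R) (n K : nat) (eps : 'I_n -> {RV P >-> R}).
Variables (q : 'I_n -> R) (b h : R).
Hypotheses (q0 : forall i, 0 <= q i) (b0 : 0 < b) (h0 : 0 < h).
Hypothesis bK : forall i, 0 < q i -> b / (h * Num.sqrt (q i)) < K.+1%:R.
Hypothesis ieps : forall i, P.-integrable setT (EFin \o eps i).
Hypothesis eps1 : forall i, (\int[P]_t (eps i t)%:E = 0)%E.
Hypothesis eps2 : forall i, (\int[P]_t (eps i t ^+ 2)%:E = 1)%E.

Let cell := grid_cell K q b h.
Let value : 'I_n -> bool * 'I_K.+1 -> R := grid_value q b h.
Let w := cell_weight eps cell.

Let mcell i a : measurable (cell i @^-1` [set a]).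
Proof. by apply: measurable_grid_cell => //; exact: ltW. Qed.

Let meps i : measurable_fun setT (eps i : T -> R).
Proof. exact: measurable_funPT. Qed.

Let ivalue i : P.-integrable setT (EFin \o (value i \o (cell i \o eps i))).
Proof. by apply: integrable_finval => a; exact: measurable_cell. Qed.

Let mvalue i : measurable_fun setT (value i \o (cell i \o eps i)).
Proof. by apply/measurable_EFinP; case/integrableP: (ivalue i). Qed.

Lemma grid_second_moment i : \sum_a w i a * value i a ^+ 2 <= 1.
Proof.
have := integral_finval P (measurable_cell eps mcell i) (fun a => value i a ^+ 2).
rewrite -/(w i _) => e; rewrite -lee_fin -[X in (X <= _)%E]e -(eps2 i).
apply: ge0_le_integral => //.
- by move=> t _; rewrite lee_fin sqr_ge0.
- apply/measurable_EFinP; exact: measurable_funX (mvalue i).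
- by apply/measurable_EFinP; exact: measurable_funX.
move=> t _; rewrite lee_fin -[leLHS]real_normK ?num_real//.
rewrite -[leRHS]real_normK ?num_real// ler_sqr ?nnegrE//.
by apply: grid_value_le => //; exact: ltW.
Qed.

(** Inside the truncation domain the error is at most the mesh. Outside, |x| sqrt(q_i) > b, hence
    |x| <= x^2 sqrt(q_i) / b. *)
Let dist_le i x : 0 < q i ->
  `|x - value i (cell i x)| <= h + x ^+ 2 * (Num.sqrt (q i) / b).
Proof.
move=> qi; have sq : 0 < Num.sqrt (q i) by rewrite sqrtr_gt0.
have r0 : 0 <= x ^+ 2 * (Num.sqrt (q i) / b).
  by rewrite mulr_ge0 ?sqr_ge0// divr_ge0// ltW.
have [tx|tx] := boolP (trunc_dom q b i x).
  apply: (@le_trans _ _ h); last by rewrite lerDl.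
  by apply: grid_value_near => //; exact: ltW.
apply: (@le_trans _ _ `|x|); first by apply: grid_value_dist => //; exact: ltW.
apply: (@le_trans _ _ (x ^+ 2 * (Num.sqrt (q i) / b))); last by rewrite lerDr ltW.
move: tx; rewrite /trunc_dom qi /= -ltNge => bx.
have {bx} bx : b <= `|x| * Num.sqrt (q i).
  rewrite -ler_sqr ?nnegrE ?(ltW b0)// ?mulr_ge0 ?(ltW sq)//.
  by rewrite exprMn real_normK ?num_real// sqr_sqrtr ltW.
rewrite mulrA ler_pdivlMr// -[x ^+ 2]real_normK ?num_real// expr2 -mulrA.
by rewrite ler_wpM2l.
Qed.

(** The noise is centred, so the mean after rounding is minus the mean error, which [dist_le] and
    the unit second moment control. *)
Lemma grid_mean i : `|\sum_a w i a * value i a| <= h + Num.sqrt (q i) / b.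
Proof.
have m0 : 0 <= h + Num.sqrt (q i) / b.
  by rewrite addr_ge0 ?divr_ge0// ltW.
have := q0 i; rewrite le_eqVlt => /predU1P[/esym qi0|qi].
  rewrite big1 ?normr0// => a _.
  by rewrite /value grid_value0 ?mulr0.
have e := integral_finval P (measurable_cell eps mcell i) (value i).
rewrite -lee_fin -abse_EFin -[X in (`|X| <= _)%E]e.
have -> : (\int[P]_t (value i ((cell i \o eps i) t))%:E =
    - \int[P]_t (eps i t - value i (cell i (eps i t)))%:E)%E.
  under [in RHS]eq_integral => t _ do rewrite EFinB.
  rewrite integralB//=; [|exact: ieps|exact: ivalue].
  by rewrite eps1 sub0e oppeK.
rewrite abseN; apply: le_trans (le_abse_integral _ _ _) _ => //.
  by apply/measurable_EFinP; apply: measurable_funB => //; exact: mvalue.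
apply: (@le_trans _ _ (\int[P]_t (h + eps i t ^+ 2 * (Num.sqrt (q i) / b))%:E)%E).
  apply: ge0_le_integral => //.
  - apply: measurableT_comp => //; apply/measurable_EFinP.
    by apply: measurable_funB => //; exact: mvalue.
  - apply/measurable_EFinP; apply: measurable_funD => //.
    by apply: measurable_funM => //; exact: measurable_funX.
  by move=> t _; rewrite abse_EFin lee_fin; exact: dist_le.
have s0 : 0 <= Num.sqrt (q i) / b by rewrite divr_ge0// ltW.
under eq_integral => t _ do rewrite EFinD EFinM.
rewrite ge0_integralD//=.
- rewrite ge0_integralZr//=.
  + by rewrite eps2 mul1e integral_cst_prob.
  + by apply/measurable_EFinP; exact: measurable_funX.
  + by move=> t _; rewrite lee_fin sqr_ge0.
- by move=> t _; rewrite lee_fin ltW.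
- by move=> t _; rewrite -EFinM lee_fin mulr_ge0 ?sqr_ge0.
- apply/measurable_EFinP; apply: measurable_funM => //; exact: measurable_funX.
Qed.

End GridMoments.

(** * Concentration of quadratic forms *)

Section Contractions.
Context {R : realType} {n N : nat}.
Implicit Types W : 'M[R]_(N, n).

Definition nonexpansive W := forall x, dot (W *m x) (W *m x) <= dot x x.

(** |W'x|^2 = <W W'x, x> <= |W W'x| |x| <= |W'x| |x|. *)
Lemma nonexpansive_tr W : nonexpansive W ->
  forall x, dot (W^T *m x) (W^T *m x) <= dot x x.
Proof.
move=> cW x; set a := dot _ _.
have a0 : 0 <= a by exact: dot_ge0.
have e : dot (W *m (W^T *m x)) x = a by rewrite dot_mulmx.
have h : a ^+ 2 <= a * dot x x.
  rewrite -[in leLHS]e; apply: le_trans (cauchy_schwarz _ _) _.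
  by rewrite ler_wpM2r ?dot_ge0// cW.
move: a0; rewrite le_eqVlt => /predU1P[<-|a0]; first exact: dot_ge0.
by move: h; rewrite expr2 ler_pM2l.
Qed.

Lemma mulmx_cols W x : W *m x = \sum_i x i 0 *: col i W.
Proof.
apply/colP => k; rewrite mxE summxE; apply: eq_bigr => i _.
by rewrite !mxE mulrC.
Qed.

(** Over all columns the sum of squares is |W'x|^2. *)
Lemma nonexpansive_frame W l : uniq l -> nonexpansive W ->
  frame_le1 (fun i => col i W) l.
Proof.
move=> ul cW x; apply: le_trans (nonexpansive_tr cW x).
have e i : dot (col i W) x = (W^T *m x) i 0.
  by rewrite /dot mxE; apply: eq_bigr => k _; rewrite !mxE.
under eq_bigr do rewrite e.
rewrite big_uniq//= /dot; under [in leRHS]eq_bigr do rewrite -expr2.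
rewrite [leRHS](bigID (mem l))/= lerDl sumr_ge0// => i _; exact: sqr_ge0.
Qed.

Lemma dotD_le (a r : 'cV[R]_N) mu : 0 < mu ->
  dot (a + r) (a + r) <= (1 + mu) * dot a a + (1 + mu^-1) * dot r r.
Proof.
move=> mu0; have := dot_ge0 (mu *: a - r).
rewrite !dotDl !dotDr !dotNl !dotNr !dotZl !dotZr (dotC r a) => h.
have im0 : 0 < mu^-1 by rewrite invr_gt0.
have : 0 <= mu^-1 * (mu * (mu * dot a a) + - (mu * dot a r) + (- (mu * dot a r) - - dot r r)).
  rewrite mulr_ge0// ?ltW//; move: h; lra.
have -> : mu^-1 * (mu * (mu * dot a a) + - (mu * dot a r) + (- (mu * dot a r) - - dot r r))
  = mu * dot a a - 2 * dot a r + mu^-1 * dot r r by field; rewrite gt_eqF.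
by lra.
Qed.

End Contractions.

Section ConcentrationParameters.
Context {R : realType} (mu z Z y lam b2 al : R).
Hypotheses (mu0 : 0 < mu) (mu1 : mu <= 1) (Zmu : (8 * 8 * 8) / mu ^+ 2 <= Z).
Hypotheses (zZ : Z ^+ 8 <= z) (lamE : lam = Z / z) (b2E : b2 = z / Z ^+ 4).
Hypotheses (alE : al = mu / 8) (yE : y = z / (1 + mu) ^+ 2).

(** The scales balance as follows: lam b^2 = Z^-3 and lam b sqrt(y) <= 1/Z keep each step in the
    range of the quadratic expansion, while lam z = Z leaves a final exponent of order -mu Z. The
    passage from [z] to [y] leaves room for the rounding error. *)
Let Zmu2 : 8 * 8 * 8 <= Z * mu ^+ 2.
Proof. by rewrite -ler_pdivrMr// exprn_gt0. Qed.

Let Z_large : 8 * 8 * 8 <= Z.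
Proof.
apply: le_trans Zmu; rewrite ler_pdivlMr ?exprn_gt0// ler_piMr//.
by rewrite exprn_ile1// ltW.
Qed.

Let Zmu1 : 8 * 8 * 8 <= Z * mu.
Proof.
apply: le_trans Zmu2 _; rewrite ler_wpM2l//; first by move: Z_large; lra.
by rewrite expr2 ger_pMr.
Qed.

Let Z0 : 0 < Z. Proof. by move: Z_large; lra. Qed.
Let z0 : 0 < z. Proof. by apply: lt_le_trans zZ; rewrite exprn_gt0. Qed.

Let lam_le : lam * Z ^+ 7 <= 1.
Proof.
rewrite lamE mulrAC ler_pdivrMr// mul1r; apply: le_trans zZ.
by rewrite -exprS.
Qed.

Let lam_b2 : lam * b2 = (Z ^+ 3)^-1.
Proof. by rewrite lamE b2E; field; rewrite !gt_eqF. Qed.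

Let lam0 : 0 < lam. Proof. by rewrite lamE divr_gt0. Qed.

Let Zpow k : 1 <= Z ^+ k.
Proof. by rewrite exprn_ege1//; move: Z_large; lra. Qed.

Let lamZ : lam * Z <= 1.
Proof.
apply: le_trans lam_le; rewrite ler_wpM2l// ?(ltW lam0)//.
by rewrite [in leRHS]exprS ler_peMr// ltW.
Qed.

Let lam_mu : lam * (8 * 8 * 8) <= mu.
Proof.
have h : lam * (8 * 8 * 8) <= lam * (Z * mu) by rewrite ler_wpM2l// ltW.
apply: le_trans h _; rewrite mulrA -[leRHS]mul1r ler_wpM2r//; exact: ltW.
Qed.

Let y0 : 0 < y. Proof. by rewrite yE divr_gt0// exprn_gt0// addr_gt0. Qed.

Let yz : y <= z.
Proof.
rewrite yE ler_pdivrMr ?exprn_gt0 ?addr_gt0// ler_peMr ?(ltW z0)//.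
by rewrite exprn_ege1// lerDl ltW.
Qed.

Lemma concentration_gam : al + 16 * lam <= mu / 4.
Proof. by rewrite alE; move: lam_mu mu0; lra. Qed.

Lemma concentration_small : lam * (4 * Num.sqrt b2 * Num.sqrt y + 2 * b2) <= 2^-1.
Proof.
have b20 : 0 <= b2 by rewrite b2E divr_ge0 ?exprn_ge0// ltW.
have h1 : lam * (Num.sqrt b2 * Num.sqrt y) <= Z^-1.
  apply: (@le_trans _ _ (lam * (z / Z ^+ 2))).
    rewrite ler_wpM2l ?(ltW lam0)// -sqrtrM//.
    have -> : z / Z ^+ 2 = Num.sqrt ((z / Z ^+ 2) ^+ 2).
      by rewrite sqrtr_sqr ger0_norm// divr_ge0 ?exprn_ge0// ltW.
    rewrite ler_wsqrtr// b2E expr_div_n -exprM expr2 mulrAC ler_wpM2r//.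
      by rewrite invr_ge0 exprn_ge0// ltW.
    by rewrite ler_wpM2l// ltW.
  by rewrite lamE le_eqVlt; apply/orP; left; apply/eqP; field; rewrite !gt_eqF.
have h2 : Z^-1 <= (8 * 8 * 8)^-1 by rewrite lef_pV2// posrE.
have h3 : (Z ^+ 3)^-1 <= (8 * 8 * 8)^-1.
  rewrite lef_pV2// ?posrE ?exprn_gt0//; apply: le_trans Z_large _.
  by rewrite exprS ler_peMr// ltW.
have -> : lam * (4 * Num.sqrt b2 * Num.sqrt y + 2 * b2)
  = 4 * (lam * (Num.sqrt b2 * Num.sqrt y)) + 2 * (lam * b2) by ring.
by rewrite lam_b2; move: h1 h2 h3; lra.
Qed.

(** Of the four factors 1 + mu, two are spent in y = z / (1 + mu)^2, one on the constant multiplying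
    [TT], and the last leaves the gap y - y / (1 + mu) >= y mu / 2. The means use at most half of
    this gap, and z <= 4 y does the rest. *)
Lemma concentration_exponent (TT S2 : R) : 0 <= TT -> (1 + mu) ^+ 4 * TT <= z ->
  S2 <= 2 * (mu / (1 + mu)) ^+ 2 + 2 * TT / b2 ->
  lam * (TT * ((1 + 8 * lam * b2) / (1 - (al + 16 * lam))) + S2 / al - y)
  <= - (mu * Z / 16).
Proof.
move=> T0 Tz S2le.
have m1 : 0 < 1 + mu by rewrite addr_gt0.
have gam1 := concentration_gam.
have g1 : 0 < 1 - (al + 16 * lam) by move: gam1 mu1; lra.
have lb : 8 * lam * b2 <= mu / 4.
  rewrite -mulrA lam_b2; have : (Z ^+ 3)^-1 <= mu / (8 * 8 * 8).
    rewrite -[leRHS]invrK lef_pV2 ?posrE ?invr_gt0 ?divr_gt0 ?exprn_gt0// invf_div.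
    rewrite ler_pdivrMr//; apply: le_trans Zmu1 _; rewrite ler_wpM2r// ?(ltW mu0)//.
    by rewrite exprS ler_peMr// ltW.
  by move: mu0; lra.
have kap : (1 + 8 * lam * b2) / (1 - (al + 16 * lam)) <= 1 + mu.
  rewrite ler_pdivrMr//; apply: (@le_trans _ _ ((1 + mu) * (1 - mu / 4))).
    have : mu * mu <= mu by rewrite ger_pMr.
    by move: lb mu0; lra.
  by rewrite ler_wpM2l ?(ltW m1)//; move: gam1; lra.
have Ty : TT * (1 + mu) <= y / (1 + mu).
  rewrite yE ler_pdivlMr// ler_pdivlMr ?exprn_gt0//.
  by apply: le_trans Tz; rewrite le_eqVlt; apply/orP; left; apply/eqP; ring.
have Tk : TT * ((1 + 8 * lam * b2) / (1 - (al + 16 * lam))) <= y / (1 + mu).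
  by apply: le_trans Ty; rewrite ler_wpM2l.
have z4 : z <= 4 * y.
  rewrite yE mulrA ler_pdivlMr ?exprn_gt0// mulrC ler_wpM2r ?(ltW z0)//.
  by rewrite expr2; move: mu0 mu1; nra.
have S2Z : S2 <= 4 * Z ^+ 4.
  apply: le_trans S2le _.
  have h1 : (mu / (1 + mu)) ^+ 2 <= Z ^+ 4.
    apply: le_trans (Zpow 4); rewrite expr_le1// ?divr_ge0 ?(ltW mu0) ?(ltW m1)//.
    by rewrite ler_pdivrMr// mul1r lerDr.
  have h2 : TT / b2 <= Z ^+ 4.
    rewrite b2E invf_div mulrCA ler_piMr ?exprn_ge0 ?(ltW Z0)//.
    rewrite ler_pdivrMr// mul1r; apply: le_trans Tz; rewrite ler_peMl//.
    by rewrite exprn_ege1// lerDl ltW.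
  by rewrite -mulrA; move: h1 h2; lra.
have S2a : S2 / al <= y * mu / 4.
  rewrite ler_pdivrMr; last by rewrite alE divr_gt0.
  apply: le_trans S2Z _; rewrite alE.
  have hz : Z ^+ 4 * (8 * 8 * 8) <= z * mu ^+ 2.
    apply: (@le_trans _ _ (Z ^+ 4 * (Z * mu ^+ 2))).
      by rewrite ler_wpM2l ?exprn_ge0// ltW.
    rewrite mulrA -exprSr ler_wpM2r ?sqr_ge0//; apply: le_trans zZ.
    by rewrite ler_eXn2l//; move: Z_large; lra.
  have : z * mu ^+ 2 <= 4 * y * mu ^+ 2 by rewrite ler_wpM2r ?sqr_ge0.
  by rewrite expr2 in hz *; move: hz; lra.
have ym : y / (1 + mu) <= y - y * mu / 2.
  rewrite ler_pdivrMr//; have : mu * (y * mu) <= y * mu.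
    by rewrite ler_piMl// mulr_ge0// ltW.
  by move: (mulr_gt0 y0 mu0); lra.
have yb : lam * (TT * ((1 + 8 * lam * b2) / (1 - (al + 16 * lam))) + S2 / al - y)
    <= lam * (- (y * mu / 4)).
  by rewrite ler_wpM2l ?(ltW lam0)//; move: Tk S2a ym; lra.
apply: le_trans yb _; rewrite mulrN lerN2.
have : lam * (z * mu / 16) <= lam * (y * mu / 4).
  rewrite ler_wpM2l ?(ltW lam0)//.
  by have := ler_wpM2r (ltW mu0) z4; lra.
apply: le_trans; rewrite le_eqVlt; apply/orP; left; apply/eqP; rewrite lamE; field.
by rewrite gt_eqF.
Qed.

End ConcentrationParameters.

Lemma measure_bigsetU_le d (T : measurableType d) (R : realType)
    (P : {measure set T -> \bar R}) (I : finType) (F : I -> set T) :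
  (forall i, measurable (F i)) ->
  (P (\big[setU/set0]_i F i) <= \sum_i P (F i))%E.
Proof.
move=> mF; pose K (A : set T) s := measurable A /\ (P A <= s)%E.
suff [] : K (\big[setU/set0]_i F i) (\sum_i P (F i))%E by [].
apply: big_rec2 => [|i s A _ [mA As]]; first by split; rewrite ?measure0.
split; first exact: measurableU.
by apply: le_trans (measureU2 _ _ _) _ => //; exact: leeD.
Qed.

Section Concentration.
Context {d : measure_display} {T : measurableType d} {R : realType}.
Variables (P : probability T R) (n N : nat) (eps : 'I_n -> {RV P >-> R}).
Hypothesis indep : mutually_independent eps.
Hypothesis ieps : forall i, P.-integrable setT (EFin \o eps i).
Hypothesis eps1 : forall i, (\int[P]_t (eps i t)%:E = 0)%E.
Hypothesis eps2 : forall i, (\int[P]_t (eps i t ^+ 2)%:E = 1)%E.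
Variable W : 'M[R]_(N, n).
Hypothesis cW : nonexpansive W.

Definition noise t : 'cV[R]_n := \col_i eps i t.

(** The diagonal of the Gram matrix W'W; it sums to the squared Hilbert-Schmidt norm of W. *)
Definition gram i : R := dot (col i W) (col i W).

Definition quad t : R := dot (W *m noise t) (W *m noise t).

Lemma measurable_noise i : measurable_fun setT (fun t => eps i t).
Proof. exact: measurable_funPT. Qed.

Lemma measurable_quad : measurable_fun setT quad.
Proof.
apply: measurable_sum => k.
have mk : measurable_fun setT (fun t => (W *m noise t) k 0).
  under eq_fun do rewrite mxE.
  apply: measurable_sum => i; under eq_fun do rewrite mxE.
  by apply: measurable_funM => //; exact: measurable_noise.
exact: measurable_funM.
Qed.

Lemma measurable_quad_gt c : measurable [set t | c < quad t].
Proof. by apply: measurable_gt; exact: measurable_quad. Qed.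

Lemma measurable_trunc_event i c : measurable [set t | c < eps i t ^+ 2 * gram i].
Proof.
apply: measurable_gt; apply: measurable_funM => //.
by apply: measurable_funX; exact: measurable_noise.
Qed.

(** If no coordinate passes the truncation level, W eps differs from its discretization by a vector
    of norm at most mu / (1 + mu). As z >= 1, this error is absorbed by lowering the threshold from
    z to z / (1 + mu)^2. *)
Lemma concentration (mu z Z : R) : 0 < mu -> mu <= 1 ->
  (8 * 8 * 8) / mu ^+ 2 <= Z -> Z ^+ 8 <= z ->
  (1 + mu) ^+ 4 * (\sum_i gram i) <= z ->
  (P [set t | (z < quad t)%R] <=
   \sum_i P [set t | (z / Z ^+ 4 < eps i t ^+ 2 * gram i)%R]
   + (expR (- (mu * Z / 16)))%:E)%E.
Proof.
move=> mu0 mu1 Zmu zZ zT.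
have Z0 : 0 < Z by apply: lt_le_trans Zmu; rewrite divr_gt0// exprn_gt0.
have Z_large : 8 * 8 * 8 <= Z.
  apply: le_trans Zmu; rewrite ler_pdivlMr ?exprn_gt0// ler_piMr// exprn_ile1//.
  exact: ltW.
have z0 : 0 < z by apply: lt_le_trans zZ; rewrite exprn_gt0.
have z1 : 1 <= z.
  by apply: le_trans zZ; rewrite exprn_ege1//; apply: le_trans Z_large; lra.
pose lam := Z / z; pose al := mu / 8; pose b := Num.sqrt z / Z ^+ 2.
pose y := z / (1 + mu) ^+ 2.
(* The mesh is chosen so that n h^2 <= (mu / (1 + mu))^2; [n.+1] keeps it positive for n = 0. *)
pose h := mu / (1 + mu) / n.+1%:R.
have m10 : 0 < 1 + mu by rewrite addr_gt0.
have h0 : 0 < h by rewrite divr_gt0// divr_gt0.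
have b0 : 0 < b by rewrite divr_gt0 ?sqrtr_gt0// exprn_gt0.
have b2 : b ^+ 2 = z / Z ^+ 4.
  by rewrite expr_div_n sqr_sqrtr ?(ltW z0)// -exprM.
have q0 i : 0 <= gram i by exact: dot_ge0.
(* A sum instead of a maximum gives one grid size valid for all coordinates. *)
pose K := (\sum_i Num.truncn (b / (h * Num.sqrt (gram i))))%N.
have bK i : 0 < gram i -> b / (h * Num.sqrt (gram i)) < K.+1%:R.
  move=> _; apply: lt_le_trans (truncnS_gt _) _.
  by rewrite ler_nat ltnS /K (bigD1 i)//= leq_addr.
have y0 : 0 <= y by rewrite divr_ge0 ?exprn_ge0// ltW.
have lam0 : 0 < lam by rewrite divr_gt0.
have al0 : 0 < al by rewrite divr_gt0.
have bE : b = Num.sqrt (b ^+ 2) by rewrite sqrtr_sqr gtr0_norm.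
have gam1 : al + 16 * lam <= 2^-1.
  by apply: le_trans (concentration_gam mu0 mu1 Zmu zZ erefl erefl) _; lra.
have small : lam * (4 * b * Num.sqrt y + 2 * b ^+ 2) <= 2^-1.
  rewrite [X in 4 * X]bE.
  exact: (concentration_small mu0 mu1 Zmu zZ erefl b2 erefl).
have nh : n%:R * h ^+ 2 <= (mu / (1 + mu)) ^+ 2.
  rewrite /h expr_div_n mulrCA ler_piMr ?sqr_ge0// ler_pdivrMr ?exprn_gt0// mul1r.
  rewrite expr2 (le_trans (_ : _ <= n.+1%:R)) ?ler_nat// ler_peMr//.
  by rewrite ler1n.
set cell := grid_cell K gram b h.
set value := @grid_value R n K gram b h.
have mcell i a : measurable (cell i @^-1` [set a]).
  by apply: measurable_grid_cell => //; exact: ltW.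
pose disc t := \sum_i value i (cell i (eps i t)) *: col i W.
have mdisc : measurable [set t | y < dot (disc t) (disc t)].
  exact: measurable_cell_sum.
have sub : [set t | z < quad t] `<=`
    (\big[setU/set0]_(i < n) [set t | z / Z ^+ 4 < eps i t ^+ 2 * gram i])
    `|` [set t | y < dot (disc t) (disc t)].
  move=> t /= zq; rewrite -bigcup_seq.
  have [good|] := pselect (forall i, eps i t ^+ 2 * gram i <= z / Z ^+ 4); last first.
    move=> /existsNP[i /negP]; rewrite -ltNge => bi; left; exists i => //=.
    by rewrite mem_index_enum.
  right; rewrite /=.
  (* On a zero column the noise is not rounded and may be large, but it does not contribute to W
     eps. *)
  pose del : 'cV[R]_n := \col_i (if 0 < gram i
    then eps i t - value i (cell i (eps i t)) else 0).
  have e : W *m noise t = disc t + W *m del.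
    rewrite !mulmx_cols -big_split /=; apply: eq_bigr => i _.
    rewrite !mxE; case: ifPn => qi; first by rewrite -scalerDl subrKC.
    have -> : col i W = 0.
      by apply: dot_eq0; apply/eqP; rewrite eq_le q0 andbT leNgt.
    by rewrite !scaler0 addr0.
  have dd : dot del del <= n%:R * h ^+ 2.
    rewrite /dot -[n in n%:R]card_ord -sumr_const.
    rewrite mulr_suml ler_sum// => i _; rewrite mul1r -expr2 mxE.
    case: ifPn => qi; last by rewrite expr0n sqr_ge0.
    rewrite -[leLHS]real_normK ?num_real// ler_sqr ?nnegrE ?(ltW h0)//.
    apply: grid_value_near => //; first exact: ltW.
    by rewrite /trunc_dom qi b2 /=.
  have := dotD_le (disc t) (W *m del) mu0; rewrite -e -/(quad t).
  have rr := le_trans (cW del) (le_trans dd nh).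
  move=> qle; rewrite /y ltr_pdivrMr ?exprn_gt0//.
  have : z < (1 + mu) * dot (disc t) (disc t) + (1 + mu^-1) * (mu / (1 + mu)) ^+ 2.
    apply: lt_le_trans zq (le_trans qle _); rewrite lerD2l ler_wpM2l//.
    by rewrite addr_ge0// invr_ge0 ltW.
  have -> : (1 + mu^-1) * (mu / (1 + mu)) ^+ 2 = mu / (1 + mu).
    by field; rewrite !gt_eqF.
  move=> zlt; have {zlt} : (1 + mu) * z < (1 + mu) * ((1 + mu) * dot (disc t) (disc t) + mu / (1 + mu)).
    by rewrite ltr_pM2l.
  rewrite mulrDr (mulrC _ (mu / _)) divfK ?gt_eqF//.
  have : mu <= mu * z by rewrite ler_peMr// ltW.
  by rewrite expr2; lra.
have mbad : measurable (\big[setU/set0]_(i < n) [set t | z / Z ^+ 4 < eps i t ^+ 2 * gram i]).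
  by apply: bigsetU_measurable => i _; exact: measurable_trunc_event.
have mq := measurable_quad_gt z.
apply: le_trans (le_measure _ _ _ sub) _; rewrite ?inE//; first exact: measurableU.
apply: le_trans (measureU2 _ _ _) _ => //; apply: leeD.
  by apply: measure_bigsetU_le => i; exact: measurable_trunc_event.
have e := prob_cell_sum value (fun i => col i W) y indep mcell.
apply: le_trans (_ : _ <= (tailprob (fun i => col i W) (cell_weight eps cell)
  value y (enum 'I_n) 0)%:E)%E _; first by rewrite -e.
rewrite lee_fin.
apply: le_trans (tailprob_le (m := fun i => h + Num.sqrt (gram i) / b)
  (cell_weight_ge0 _ _) (sum_cell_weight _ _) _ _ _ (ltW b0) lam0 al0 gam1 y0 small
  0 (nonexpansive_frame (enum_uniq _) cW)) _ => //.
- by move=> i a; apply: grid_value_sqr => //; exact: ltW.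
- by move=> i; exact: grid_second_moment.
- by move=> i; exact: grid_mean.
rewrite ler_expR mulmx0 dot0l add0r big_enum/= big_split/= -mulr_suml -mulr_suml.
apply: (concentration_exponent mu0 mu1 Zmu zZ) => //.
  by apply: sumr_ge0 => i _; exact: q0.
apply: (@le_trans _ _ (\sum_(i < n) (2 * h ^+ 2 + 2 * gram i / b ^+ 2))).
  apply: ler_sum => i _.
  have -> : 2 * gram i / b ^+ 2 = 2 * (Num.sqrt (gram i) / b) ^+ 2.
    by rewrite [(_ / b) ^+ 2]expr_div_n sqr_sqrtr ?q0// mulrA.
  have := sqr_ge0 (h - Num.sqrt (gram i) / b); lra.
rewrite big_split /= sumr_const card_ord -mulr_suml -mulr_sumr lerD2r.
by rewrite -[_ *+ n]mulr_natl mulrCA ler_wpM2l.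
Qed.

End Concentration.

(** * Polynomial tails *)

Section MomentTail.
Context {d : measure_display} {T : measurableType d} {R : realType}.
Variables (P : probability T R) (X : {RV P >-> R}) (p tau : R).
Hypothesis p2 : 2 <= p.
Hypothesis Xp : ('E_P[fun t => (`|X t| `^ p)%R] <= tau%:E)%E.

Lemma moment_tail (c : R) : 0 < c ->
  (P [set t | (c <= `|X t|)%R] <= (tau / c `^ p)%:E)%E.
Proof.
move=> c0; have p0 : 0 <= p by apply: le_trans p2.
have cp : 0 < c `^ p by rewrite powR_gt0.
have := @markov _ _ _ P X (fun r => r `^ p) c c0 (measurable_powR p)
  (fun r _ => powR_ge0 r p).
have hm : {in Num.nneg &, {homo (fun r : R => r `^ p) : x y / x <= y}}.
  by move=> x y x0 y0; exact: ge0_ler_powR.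
move=> /(_ hm) /le_trans /(_ Xp).
rewrite muleC -lee_pdivlMr// => h; apply: le_trans h.
Qed.

(** Markov's inequality gives the factor g^(p/2), at most g because g <= 1; linearity in g makes the
    sum over the columns a Hilbert-Schmidt norm. *)
Lemma trunc_event_tail (g c : R) : 0 <= g -> g <= 1 -> 0 < c ->
  (P [set t | (c < X t ^+ 2 * g)%R] <= (tau * g * c `^ (- (p / 2)))%:E)%E.
Proof.
rewrite le_eqVlt => /predU1P[<- _ c0|g0 g1 c0].
  rewrite mulr0 mul0r (_ : mkset _ = set0) ?measure0//.
  by apply/seteqP; split=> t //=; rewrite mulr0 ltNge ltW.
have cg : 0 < c / g by rewrite divr_gt0.
have s0 : 0 < Num.sqrt (c / g) by rewrite sqrtr_gt0.
have tau0 : 0 <= tau.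
  rewrite -lee_fin; apply: le_trans Xp.
  by apply: expectation_ge0 => t; exact: powR_ge0.
apply: (@le_trans _ _ (tau / (Num.sqrt (c / g)) `^ p)%:E).
  apply: le_trans (moment_tail s0); apply: le_measure; rewrite ?inE.
  - apply: measurable_gt; apply: measurable_funM => //.
    by apply: measurable_funX; exact: measurable_funPT.
  - rewrite [X in measurable X](_ : _ = setT `&` (fun t => Num.sqrt (c / g) <= `|X t|) @^-1` [set true]).
      have mX : measurable_fun setT (X : T -> R) by exact: measurable_funPT.
      apply: measurable_fun_ler => //.
      exact: measurableT_comp (@normr_measurable R setT) mX.
    by rewrite setTI; apply/seteqP; split.
  move=> t /=; rewrite -ltr_pdivrMr// => h.
  rewrite -ler_sqr ?nnegrE ?(ltW s0)// sqr_sqrtr ?(ltW cg)//.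
  by rewrite real_normK ?num_real// ltW.
rewrite lee_fin -mulrA ler_wpM2l//.
rewrite -powR12_sqrt ?(ltW cg)// -powRrM -powRN (mulrC 2^-1).
rewrite powRM ?invr_ge0 ?(ltW c0) ?(ltW g0)// [leLHS]mulrC ler_wpM2r ?powR_ge0//.
rewrite -powR_inv1 ?(ltW g0)// -powRrM mulrNN mul1r.
by apply: ge1r_powR; rewrite ?g0 ?g1// ler_pdivlMr// mul1r.
Qed.

End MomentTail.

(** e^(-u) is the k-th power of e^(-u/k), and e^(u/k) >= u/k. *)
Lemma expRN_le_powR {R : realType} (k : nat) (u : R) : 0 < u ->
  expR (- u) <= (k%:R / u) ^+ k.
Proof.
case: k => [|k] u0; first by rewrite expr0 expR_le1 oppr_le0 ltW.
have uk : 0 < u / k.+1%:R by rewrite divr_gt0.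
rewrite expRN -[u in expR u](divfK (_ : k.+1%:R != 0)) ?pnatr_eq0// expRM_natr.
rewrite -exprVn lerXn2r ?nnegrE ?invr_ge0 ?expR_ge0// ?divr_ge0 ?(ltW u0)//.
rewrite -[leRHS]invf_div lef_pV2 ?posrE ?expR_gt0//.
by apply: le_trans (expR_ge1Dx _); rewrite lerDr.
Qed.

Lemma gram_le1 {R : realType} n N (W : 'M[R]_(N, n)) i : nonexpansive W ->
  gram W i <= 1.
Proof.
move=> cW; apply: (@frame_le1_vec _ _ _ (fun i => col i W) i [::]).
exact: nonexpansive_frame.
Qed.

Lemma tail_bound {R : realType} (p dl mu : R) :
  2 <= p -> 0 < dl -> 0 < mu -> mu <= 1 ->
  exists2 C : R, 1 <= C &
  forall d (T : measurableType d) (P : probability T R) (n N : nat)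
    (eps : 'I_n -> {RV P >-> R}) (W : 'M[R]_(N, n)) (tau z : R),
  mutually_independent eps ->
  (forall i, P.-integrable setT (EFin \o eps i)) ->
  (forall i, \int[P]_t (eps i t)%:E = 0)%E ->
  (forall i, \int[P]_t (eps i t ^+ 2)%:E = 1)%E ->
  (forall i, 'E_P[fun t => (`|eps i t| `^ p)%R] <= tau%:E)%E -> 1 <= tau ->
  nonexpansive W ->
  1 <= z -> (1 + mu) ^+ 4 * (\sum_i gram W i) <= z ->
  (P [set t | (z < quad eps W t)%R]
    <= (C * tau * (1 + \sum_i gram W i) * z `^ (dl - p / 2))%:E)%E.
Proof.
move=> p2 dl0 mu0 mu1; have p0 : 0 < p by apply: lt_le_trans p2.
(* With Z = z^de, de <= 1/8 gives Z^8 <= z, and 2 p de <= dl bounds the loss when the truncation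
   level z^(1 - 4 de) is raised to the power -p/2. *)
pose de := Num.min 8^-1 (dl / (2 * p)).
have de0 : 0 < de by rewrite /de lt_min invr_gt0 ltr0n /= divr_gt0// mulr_gt0.
have de8 : de * 8%:R <= 1.
  by rewrite -ler_pdivlMr// mul1r /de ge_min lexx.
have dep : de * (2 * p) <= dl.
  by rewrite -ler_pdivlMr ?mulr_gt0// /de ge_min lexx orbT.
(* Large enough for Z^(-k) <= z^(-p/2), so the exponential term is dominated by the polynomial
   one. *)
pose k := (Num.truncn (p / 2 / de)).+1.
have kp : p / 2 <= de * k%:R.
  by rewrite [leRHS]mulrC -ler_pdivrMr// ltW// truncnS_gt.
pose c0 := 8 * 8 * 8 / mu ^+ 2 : R.
have c00 : 0 < c0 by rewrite divr_gt0// exprn_gt0.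
(* Below [z0] the parameter Z may be too small for [concentration]; there the constant makes the
   claimed bound at least 1. *)
pose z0 := Num.max 1 (c0 `^ de^-1).
pose C1 := (k%:R / (mu / 16)) ^+ k.
have C10 : 0 <= C1 by rewrite exprn_ge0// !divr_ge0// ltW.
pose e := dl - p / 2.
exists (Num.max (1 + C1) (z0 `^ `|e|)).
  by rewrite le_max lerDl C10.
move=> d T P n N eps W tau z indep ieps eps1 eps2 epsp tau1 cW z1 zT.
set TT := \sum_i gram W i.
have g0 i : 0 <= gram W i by exact: dot_ge0.
have T0 : 0 <= TT by apply: sumr_ge0.
have zp : 0 < z by apply: lt_le_trans z1.
set CC := Num.max _ _.
have CC1 : 1 + C1 <= CC by rewrite le_max lexx.
have CC2 : z0 `^ `|e| <= CC by rewrite le_max lexx orbT.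
have CC0 : 0 <= CC by apply: le_trans CC1; rewrite addr_ge0.
have [zs|zl] := ltP z z0.
  apply: (@le_trans _ _ 1%E).
    by apply: probability_le1; exact: measurable_quad_gt.
  have : 1 <= CC * z `^ e.
    apply: (@le_trans _ _ (z `^ `|e| * z `^ e)).
      rewrite -powRD; last by rewrite (gt_eqF zp) implybT.
      rewrite -[leLHS](powRr0 z) ler_powR//.
      by rewrite -lerBlDr sub0r -normrN ler_norm.
    rewrite ler_wpM2r ?powR_ge0//; apply: le_trans CC2.
    by apply: ge0_ler_powR; rewrite ?nnegrE ?normr_ge0 ?(ltW zp) ?(ltW zs)// (le_trans (ltW zp) (ltW zs)).
  rewrite lee_fin => h; rewrite -/e.
  have -> : CC * tau * (1 + TT) * z `^ e = (CC * z `^ e) * (tau * (1 + TT)) by ring.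
  rewrite -[leLHS]mulr1 ler_pM// -[leLHS]mulr1 ler_pM//.
  by rewrite lerDl.
pose Z := z `^ de.
have ZE : Z ^+ 8 <= z.
  rewrite -powR_mulrn ?powR_ge0// -powRrM -[leRHS]powRr1 ?(ltW zp)//.
  by rewrite ler_powR.
have cZ : c0 <= Z.
  have -> : c0 = (c0 `^ de^-1) `^ de by rewrite -powRrM mulVf ?gt_eqF// powRr1// ltW.
  apply: ge0_ler_powR; rewrite ?nnegrE ?(ltW de0) ?(ltW zp) ?powR_ge0//.
  by apply: le_trans zl; rewrite le_max lexx orbT.
have Zp : 0 < Z by rewrite powR_gt0.
have zr : (z / Z ^+ 4) `^ (- (p / 2)) <= z `^ e.
  have -> : z / Z ^+ 4 = z `^ (1 - de * 4%:R).
    rewrite powRB; last by rewrite (gt_eqF zp) implybT.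
    by rewrite powRr1 ?(ltW zp)// powRrM powR_mulrn// ltW.
  rewrite -powRrM ler_powR// /e; move: dep; lra.
have ez : expR (- (mu * Z / 16)) <= C1 * z `^ e.
  have u0 : 0 < mu * Z / 16 by rewrite divr_gt0// mulr_gt0.
  apply: le_trans (expRN_le_powR k u0) _.
  have -> : k%:R / (mu * Z / 16) = (k%:R / (mu / 16)) / Z.
    by field; rewrite !gt_eqF.
  rewrite exprMn ler_wpM2l// exprVn -powR_mulrn ?(ltW Zp)// -powRrM -powRN.
  by rewrite ler_powR// /e; move: kp dl0; lra.
apply: le_trans (concentration indep ieps eps1 eps2 cW mu0 mu1 cZ ZE zT) _.
apply: (@le_trans _ _ (\sum_i (tau * gram W i * z `^ e)%:E
    + (C1 * z `^ e)%:E)%E).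
  apply: leeD; last by rewrite lee_fin.
  apply: lee_sum => i _.
  apply: le_trans (trunc_event_tail p2 (epsp i) _ _ _) _ => //.
  - exact: gram_le1.
  - by rewrite divr_gt0// exprn_gt0.
  rewrite lee_fin ler_wpM2l// mulr_ge0// (le_trans _ tau1)//.
rewrite sumEFin -EFinD lee_fin -/e -mulr_suml -mulr_sumr -/TT.
rewrite -mulrDl ler_wpM2r ?powR_ge0//.
apply: (@le_trans _ _ ((1 + C1) * tau * (1 + TT))).
  have : C1 * 1 <= C1 * (tau * (1 + TT)).
    rewrite ler_wpM2l// -[leLHS]mulr1 ler_pM// lerDl//.
  have : 0 <= tau by apply: le_trans tau1.
  lra.
by rewrite !ler_wpM2r// ?addr_ge0// (le_trans _ tau1).
Qed.

(** * Dyadic integration of tails and the expected excess *)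

Lemma powR2_lt1 (R : realType) (r : R) : 1 < r -> 2 `^ (1 - r) < 1.
Proof.
move=> r1; have r0 : 0 < r - 1 by rewrite subr_gt0.
rewrite -opprB powRN invf_lt1 ?powR_gt0//.
have := gt0_ltr_powR r0 (_ : 1 \in Num.nneg) (_ : 2 \in Num.nneg) (ltr1n _ 2).
by rewrite !nnegrE powR1; apply.
Qed.

Section DyadicIntegration.
Context {d : measure_display} {T : measurableType d} {R : realType}.
Variables (P : probability T R) (G : T -> R) (K Y r : R).
Hypotheses (mG : measurable_fun setT G) (Y0 : 0 < Y) (K0 : 0 <= K) (r1 : 1 < r).
Hypothesis tailG : forall x, 0 <= x ->
  (P [set t | (x < G t)%R] <= (K * (Y + x) `^ (- r))%:E)%E.

(** Both [Y + level j] and the gap to the next level equal 2^j Y, so layer j contributes at most K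
    (2^j Y)^(1 - r), a geometric sequence of ratio 2^(1 - r). *)
Let level j : R := (2 ^+ j - 1) * Y.

Let layer j t : \bar R := (2 ^+ j * Y * \1_[set t | level j < G t] t)%:E.

Let layer_ge0 j t : (0 <= layer j t)%E.
Proof. by rewrite lee_fin mulr_ge0// mulr_ge0 ?exprn_ge0// ltW. Qed.

Let mlevel j : measurable [set t | level j < G t].
Proof.
exact: measurable_gt.
Qed.

Let mlayer j : measurable_fun setT (layer j).
Proof.
rewrite /layer; apply/measurable_EFinP; apply: measurable_funM => //.
Qed.

Let level_ge0 j : 0 <= level j.
Proof. by rewrite mulr_ge0 ?(ltW Y0)// subr_ge0 exprn_ege1// ler1n. Qed.

(** Either the first N layers already cover the positive part of [G t], or all of them are active
    and their sum telescopes to [level N]. *)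
Let partial_layers N t : (Num.max (G t) 0 <= \sum_(0 <= j < N) 2 ^+ j * Y * \1_[set t | level j < G t] t)
  \/ (\sum_(0 <= j < N) 2 ^+ j * Y * \1_[set t | level j < G t] t = level N /\ level N < G t).
Proof.
elim: N => [|N IH].
  rewrite big_nil /level expr0 subrr mul0r.
  by case: (ltP 0 (G t)) => h; [right|left].
rewrite big_nat_recr//=; case: IH => [h|[-> lt]].
  by left; apply: le_trans h _; rewrite lerDl mulr_ge0// mulr_ge0 ?exprn_ge0// ltW.
rewrite indicE mem_set// mulr1.
have -> : level N + 2 ^+ N * Y = level N.+1 by rewrite /level exprS; ring.
have [h|h] := ltP (level N.+1) (G t); [by right|left].
by rewrite ge_max h level_ge0.
Qed.

Let layer_cover t : ((Num.max (G t) 0)%:E <= \sum_(j <oo) layer j t)%E.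
Proof.
pose N := (Num.truncn (G t / Y)).+1.
have GN : G t <= level N.
  have h : G t / Y <= N%:R by rewrite ltW// truncnS_gt.
  rewrite /level; move: h; rewrite ler_pdivrMr// => /le_trans; apply.
  rewrite ler_wpM2r ?(ltW Y0)// -natrX -[1]/(1%:R) -natrB ?expn_gt0// ler_nat.
  by rewrite -ltnS -subSn ?expn_gt0// subn1 ltn_expl.
apply: le_trans (_ : _ <= \sum_(0 <= j < N) layer j t)%E _.
  rewrite sumEFin lee_fin; case: (partial_layers N t) => // -[_].
  by rewrite ltNge GN.
by apply: nneseries_lim_ge => j _ _; exact: layer_ge0.
Qed.

Lemma dyadic_integral :
  (\int[P]_t (Num.max (G t) 0)%:E <= (K * Y `^ (1 - r) / (1 - 2 `^ (1 - r)))%:E)%E.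
Proof.
set q := 2 `^ (1 - r).
have q0 : 0 < q by rewrite powR_gt0.
have q1 : q < 1 by exact: powR2_lt1.
apply: (@le_trans _ _ (\int[P]_t (\sum_(j <oo) layer j t))%E).
  apply: ge0_le_integral => //.
  - by move=> t _; rewrite lee_fin le_max lexx orbT.
  - by apply/measurable_EFinP; apply: measurable_maxr.
  - apply: ge0_emeasurable_sum => // j _ _; exact: mlayer.
rewrite integral_nneseries//.
apply: (@le_trans _ _ (\sum_(j <oo) (K * Y `^ (1 - r) * q ^+ j)%:E)%E).
  apply: lee_nneseries => [j _ _|j _]; first exact: integral_ge0.
  under eq_integral => t _ do rewrite /layer EFinM.
  rewrite integralZl//; last exact: integrable_indic.
  rewrite integral_indic// setIT.
  apply: (@le_trans _ _ ((2 ^+ j * Y)%:E * (K * (Y + level j) `^ (- r))%:E)%E).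
    apply: lee_wpmul2l; last exact: tailG.
    by rewrite lee_fin mulr_ge0 ?exprn_ge0// ltW.
  rewrite -EFinM lee_fin.
  have -> : Y + level j = 2 ^+ j * Y by rewrite /level; ring.
  have p2 : 0 < 2 ^+ j :> R by rewrite exprn_gt0.
  rewrite powRM ?(ltW p2) ?(ltW Y0)//.
  have e1 : 2 ^+ j * (2 ^+ j) `^ (- r) = q ^+ j.
    rewrite -[in X in X * _](powRr1 (ltW p2)) -powRD; last by rewrite (gt_eqF p2) implybT.
    by rewrite -powR_mulrn// -powRrM mulrC powRrM powR_mulrn ?powR_ge0.
  have e2 : Y * Y `^ (- r) = Y `^ (1 - r).
    by rewrite -[in X in X * _](powRr1 (ltW Y0)) -powRD// (gt_eqF Y0) implybT.
  rewrite le_eqVlt; apply/orP; left; apply/eqP; rewrite -e1 -e2; ring.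
have K1 : 0 <= K * Y `^ (1 - r) by rewrite mulr_ge0// powR_ge0.
apply: lime_le; first by apply: is_cvg_nneseries => j _ _; rewrite lee_fin mulr_ge0 ?exprn_ge0// ltW.
apply: nearW => N; rewrite sumEFin lee_fin -mulr_sumr ler_wpM2l//.
rewrite -[leRHS]mul1r ler_pdivlMr ?subr_gt0//.
have -> : (\sum_(0 <= i < N) q ^+ i) * (1 - q) = 1 - q ^+ N.
  elim: N => [|N IH]; first by rewrite big_nil mul0r expr0 subrr.
  by rewrite big_nat_recr//= mulrDl IH exprS; ring.
by rewrite lerBlDr lerDl exprn_ge0// ltW.
Qed.

End DyadicIntegration.

(** The small eta of the argument. By convexity (1 + eta)^5 <= 1 + 31 eta, and 62 = 2 (2^5 - 1)
    makes this at most 1 + theta / 2; four factors serve the tail bound and one is the coefficient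
    of the form. The bound 1/2 serves the cross term. *)
Definition margin {R : realType} (theta : R) : R := Num.min 2^-1 (theta / 62%:R).

Section Margin.
Context {R : realType} (theta : R).
Hypothesis theta0 : 0 < theta.

Lemma margin_gt0 : 0 < margin theta.
Proof. by rewrite lt_min invr_gt0 ltr0n divr_gt0. Qed.

Lemma margin_half : margin theta <= 2^-1.
Proof. by rewrite ge_min lexx. Qed.

Lemma margin_le1 : margin theta <= 1.
Proof. by apply: le_trans margin_half _; rewrite invf_le1// ler1n. Qed.

Lemma margin_pow5 : (1 + margin theta) ^+ 5 <= 1 + theta / 2.
Proof.
have m1 := margin_le1; have m0 := ltW margin_gt0.
have mt : 31 * margin theta <= theta / 2.
  have : margin theta <= theta / 62%:R by rewrite ge_min lexx orbT.
  by lra.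
suff h k : (1 + margin theta) ^+ k <= 1 + (2 ^+ k - 1) * margin theta.
  by apply: le_trans (h 5%N) _; move: mt; lra.
elim: k => [|k IH]; first by rewrite !expr0; lra.
have k1 : 1 <= 2 ^+ k :> R by rewrite exprn_ege1// ler1n.
rewrite exprS; apply: le_trans (ler_wpM2l (_ : 0 <= 1 + margin theta) IH) _.
  by rewrite addr_ge0.
have : (2 ^+ k - 1) * (margin theta * margin theta) <= (2 ^+ k - 1) * margin theta.
  by rewrite ler_wpM2l ?subr_ge0// ler_piMl.
rewrite [2 ^+ k.+1]exprS; set q := 2 ^+ k; set m := margin theta; lra.
Qed.

End Margin.

Lemma powRN_le {R : realType} (k x y r : R) : 0 < k -> 0 < y -> 0 <= r -> k * y <= x ->
  x `^ (- r) <= k `^ (- r) * y `^ (- r).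
Proof.
move=> k0 y0 r0 kx; rewrite -powRM ?(ltW k0) ?(ltW y0)//.
have ky : 0 < k * y by rewrite mulr_gt0.
rewrite !powRN lef_pV2 ?posrE ?powR_gt0//; last exact: lt_le_trans kx.
by apply: ge0_ler_powR; rewrite ?nnegrE ?(ltW ky)// (le_trans _ kx)// ltW.
Qed.

(** The excess passes x only if one of the two forms passes a threshold proportional to (1 + L) T +
    x. The tail bound then yields a power of (1 + L) T + 1 + x, to be integrated with Y = (1 + L) T
    + 1. *)
Lemma excess_bound {R : realType} (p dl theta : R) :
  2 <= p -> 0 < dl -> dl < p / 2 - 1 -> 0 < theta ->
  exists2 C : R, 0 <= C &
  forall d (T : measurableType d) (P : probability T R) (n N : nat)
    (eps : 'I_n -> {RV P >-> R}) (W : 'M[R]_(N, n)) (a : 'M[R]_(1, n)) (tau L : R),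
  mutually_independent eps ->
  (forall i, P.-integrable setT (EFin \o eps i)) ->
  (forall i, \int[P]_t (eps i t)%:E = 0)%E ->
  (forall i, \int[P]_t (eps i t ^+ 2)%:E = 1)%E ->
  (forall i, 'E_P[fun t => (`|eps i t| `^ p)%R] <= tau%:E)%E -> 1 <= tau ->
  nonexpansive W -> nonexpansive a -> \sum_i gram a i <= 1 -> 0 <= L ->
  (\int[P]_t (Num.max ((1 + margin theta) * quad eps W t + 2 * quad eps a t
      - (1 + theta + L) * \sum_i gram W i) 0)%:E
    <= (C * (tau * (1 + \sum_i gram W i) *
        ((1 + L) * (\sum_i gram W i) + 1) `^ (1 - (p / 2 - dl))))%:E)%E.
Proof.
move=> p2 dl0 dlp theta0.
have mu0 := margin_gt0 theta0; have mu1 := margin_le1 theta.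
have mu5 := margin_pow5 theta0.
set mu := margin theta in mu0 mu1 mu5 *.
have [C C1 tailC] := tail_bound p2 dl0 mu0 mu1.
set r := p / 2 - dl.
have r1 : 1 < r by rewrite /r; move: dlp; lra.
have r0 : 0 <= r by move: r1; lra.
pose ka := Num.min theta 1 / 4.
have ka0 : 0 < ka by rewrite divr_gt0// lt_min theta0 ltr01.
have ka1 : 4 * ka <= 1 by rewrite mulrC divfK// ge_min lexx orbT.
have kat : 4 * ka <= theta by rewrite mulrC divfK// ge_min lexx.
pose C' := 3 * C * (ka / 2) `^ (- r) + (17%:R / ka) `^ r.
have C0 : 0 <= C by apply: le_trans C1.
have C'0 : 0 <= C' by rewrite addr_ge0 ?powR_ge0// mulr_ge0 ?powR_ge0// mulr_ge0.
have q1 : 0 < 1 - 2 `^ (1 - r) by rewrite subr_gt0 powR2_lt1.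
exists (C' / (1 - 2 `^ (1 - r))); first by rewrite divr_ge0// ltW.
move=> d T P n N eps W a tau L indep ieps eps1 eps2 epsp tau1 cW ca a1 L0.
set TT := \sum_i gram W i.
have T0 : 0 <= TT by apply: sumr_ge0 => i _; exact: dot_ge0.
have tau0 : 0 <= tau by apply: le_trans tau1.
set G := fun t => (1 + mu) * quad eps W t + 2 * quad eps a t - (1 + theta + L) * TT.
have mG : measurable_fun setT G.
  apply: measurable_funB => //; apply: measurable_funD; apply: measurable_funM => //;
  exact: measurable_quad.
pose Y := (1 + L) * TT + 1.
have Y0 : 0 < Y by rewrite ltr_wpDl// mulr_ge0// addr_ge0.
have K0 : 0 <= C' * tau * (1 + TT) by rewrite !mulr_ge0// addr_ge0.
apply: le_trans (dyadic_integral (G := G) (K := C' * tau * (1 + TT)) (Y := Y) (r := r) mG Y0 K0 r1 _) _; last first.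
  by rewrite lee_fin le_eqVlt; apply/orP; left; apply/eqP; rewrite /Y; ring.
move=> x x0.
have LT0 : 0 <= L * TT by rewrite mulr_ge0.
pose V := (1 + L) * TT + x.
have V0 : 0 <= V by rewrite addr_ge0// mulr_ge0// addr_ge0.
have mGx : measurable [set t | x < G t] by exact: measurable_gt.
have YV : Y + x = V + 1 by rewrite /Y /V; ring.
have V10 : 0 < V + 1 by rewrite ltr_wpDl.
have tT1 : 1 <= tau * (1 + TT) by rewrite -[leLHS]mulr1 ler_pM// lerDl.
(* For small V the claimed bound is at least 1, since ka (V + 1) <= 17. For large V, 16 >= (1 +
   mu)^4 lets the rank-one form, whose [gram] sums to at most 1, meet the condition of the tail
   bound. *)
rewrite YV; have [Vs|Vl] := ltP (ka * V) 16%:R.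
  apply: (@le_trans _ _ 1%E); first exact: probability_le1.
  rewrite lee_fin.
  have : 1 <= (17%:R / ka) `^ r * (V + 1) `^ (- r).
    rewrite powRN ler_pdivlMr ?powR_gt0// mul1r; apply: ge0_ler_powR => //.
    - by rewrite nnegrE ltW.
    - by rewrite nnegrE divr_ge0// ltW.
    by rewrite ler_pdivlMr// mulrDl mul1r; move: Vs ka1; lra.
  have : 0 <= 3 * C * (ka / 2) `^ (- r) * (V + 1) `^ (- r).
    by rewrite !mulr_ge0 ?powR_ge0.
  move=> h1 h2; have h3 : 1 <= C' * (V + 1) `^ (- r) by rewrite mulrDl; move: h1 h2; lra.
  have -> : C' * tau * (1 + TT) * (V + 1) `^ (- r)
    = (C' * (V + 1) `^ (- r)) * (tau * (1 + TT)) by ring.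
  by rewrite -[leLHS]mulr1 ler_pM.
(* Chosen with [z2] so that (1 + mu) z1 + 2 z2 = (1 + theta + L) TT + x; half of theta stays here to
   pay for (1 + mu)^5. *)
pose z1 := ((1 + theta / 2 + L / 2) * TT + x / 2) / (1 + mu).
pose z2 := ((theta + L) * TT + x) / 4.
have tT0 : 0 <= theta * TT by rewrite mulr_ge0// ltW.
have m10 : 0 < 1 + mu by rewrite addr_gt0.
have zV1 : ka * V <= z1.
  rewrite /z1 ler_pdivlMr//; apply: (@le_trans _ _ (V / 4 * 2)); last first.
    by rewrite /V; move: tT0; lra.
  apply: ler_pM; rewrite ?addr_ge0 ?(ltW mu0)//.
  - by rewrite mulr_ge0// ltW.
  - by have := ler_wpM2r V0 ka1; lra.
  - by move: mu1; lra.
have zV2 : ka * V <= z2.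
  rewrite /z2 ler_pdivlMr//.
  have h1 := ler_wpM2r T0 kat; have h2 := ler_wpM2r LT0 ka1; have h3 := ler_wpM2r x0 ka1.
  by rewrite /V; move: h1 h2 h3; lra.
have kV : ka / 2 * (V + 1) <= ka * V.
  have : 1 <= V by move: Vl V0 ka1; nra.
  by move=> /(ler_wpM2l (ltW ka0)); lra.
have k20 : 0 < ka / 2 by rewrite divr_gt0.
have p1 := powRN_le k20 V10 r0 (le_trans kV zV1).
have p2' := powRN_le k20 V10 r0 (le_trans kV zV2).
have sub : [set t | x < G t] `<=` [set t | z1 < quad eps W t] `|` [set t | z2 < quad eps a t].
  move=> t /= xG; have [h|h] := ltP z1 (quad eps W t); [by left|right].
  rewrite ltNge; apply/negP => h2; move: xG; apply/negP; rewrite -leNgt /G.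
  move: h; rewrite /z1 ler_pdivlMr// mulrC => h.
  by move: h h2; rewrite /z2; lra.
apply: le_trans (le_measure _ _ _ sub) _; rewrite ?inE//.
  by apply: measurableU; exact: measurable_quad_gt.
apply: le_trans (measureU2 _ _ _) _; [exact: measurable_quad_gt|exact: measurable_quad_gt|].
have pe : dl - p / 2 = - r by rewrite /r opprB.
have t1 := tailC d T P n N eps W tau z1 indep ieps eps1 eps2 epsp tau1 cW.
have t2 := tailC d T P n 1%N eps a tau z2 indep ieps eps1 eps2 epsp tau1 ca.
have z11 : 1 <= z1 by apply: le_trans zV1; apply: le_trans Vl; rewrite ler1n.
have z21 : 1 <= z2 by apply: le_trans zV2; apply: le_trans Vl; rewrite ler1n.
have z1T : (1 + mu) ^+ 4 * TT <= z1.
  rewrite /z1 ler_pdivlMr// mulrAC -exprSr.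
  apply: le_trans (ler_wpM2r T0 mu5) _; move: LT0 x0; lra.
have z2T : (1 + mu) ^+ 4 * \sum_i gram a i <= z2.
  apply: le_trans zV2; apply: le_trans Vl.
  have g0 : 0 <= \sum_i gram a i by apply: sumr_ge0 => i _; exact: dot_ge0.
  have m16 : (1 + mu) ^+ 4 <= 2 ^+ 4.
    by rewrite lerXn2r ?nnegrE// ?(ltW m10)//; move: mu1; lra.
  rewrite -[leRHS]mulr1 ler_pM ?exprn_ge0 ?(ltW m10)//.
  by apply: le_trans m16 _; rewrite -natrX.
apply: le_trans (leeD (t1 z11 z1T) (t2 z21 z2T)) _.
rewrite -EFinD lee_fin pe -/TT.
have h1 : C * tau * (1 + TT) * z1 `^ (- r) <=
    C * tau * (1 + TT) * ((ka / 2) `^ (- r) * (V + 1) `^ (- r)).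
  by rewrite ler_wpM2l// !mulr_ge0// addr_ge0.
have h2 : C * tau * (1 + \sum_i gram a i) * z2 `^ (- r) <=
    C * tau * (2 * (1 + TT)) * ((ka / 2) `^ (- r) * (V + 1) `^ (- r)).
  have g0 : 0 <= \sum_i gram a i by apply: sumr_ge0 => i _; exact: dot_ge0.
  apply: ler_pM; rewrite ?powR_ge0 ?mulr_ge0 ?addr_ge0//.
  by rewrite ler_wpM2l ?mulr_ge0//; move: a1 T0; lra.
have h3 : 0 <= (17%:R / ka) `^ r * (tau * (1 + TT) * (V + 1) `^ (- r)).
  by rewrite !mulr_ge0 ?powR_ge0// addr_ge0.
rewrite /C'; move: h1 h2 h3.
set A1 := z1 `^ (- r); set A2 := z2 `^ (- r); set A3 := (V + 1) `^ _.
set A4 := (ka / 2) `^ _; set A5 := (_ / ka) `^ r.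
have -> : (3 * C * A4 + A5) * tau * (1 + TT) * A3 =
   C * tau * (1 + TT) * (A4 * A3) + C * tau * (2 * (1 + TT)) * (A4 * A3)
   + A5 * (tau * (1 + TT) * A3) by ring.
by lra.
Qed.

(** * Summation over the models *)

Lemma counting_finite {R : realType} (T : choiceType) (X : set T) (x : R) :
  (counting X <= x%:E :> \bar R)%E -> finite_set X.
Proof. by rewrite /counting; case: asboolP => //; rewrite leye_eq. Qed.

Lemma count_le_counting {R : realType} (T : choiceType) (X : set T) (f : pred T)
    (s : seq T) (x : R) : uniq s -> (forall m, f m -> X m) ->
  (counting X <= x%:E :> \bar R)%E -> (count f s)%:R <= x.
Proof.
move=> us fX Xx; have Xfin := counting_finite Xx; move: Xx.
rewrite /counting asboolT// lee_fin; apply: le_trans; rewrite ler_nat -size_filter.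
apply: uniq_leq_size; first exact: filter_uniq.
by move=> m; rewrite mem_filter => /andP[/fX Xm _]; rewrite in_fset_set// inE.
Qed.

(** Dimensions are at most n and each is attained finitely often, so the whole collection is finite
    and can be summed as a list. *)
Lemma finite_models {R : realType} (n : nat) (M : countType)
    (S : M -> {vspace 'cV[R]_n}) (f : nat -> R) :
  (forall k, (ndim S k <= (f k)%:E)%E) ->
  exists s : seq M, [/\ uniq s, forall m, m \in s &
    forall k, (count (fun m => \dim (S m) == k) s)%:R <= f k].
Proof.
move=> Sf; have Tfin : finite_set [set: M].
  rewrite (_ : setT = \bigcup_(k in `I_n.+1) [set m | \dim (S m) = k]).
    by apply: bigcup_finite => // k _; exact: counting_finite (Sf k).
  apply/seteqP; split => m // _; exists (\dim (S m)) => //=.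
  by rewrite ltnS; have := dimvS (subvf (S m)); rewrite dimvf /dim /= muln1.
exists (fset_set [set: M]); split; first exact: fset_uniq.
  by move=> m; rewrite in_fset_set// inE.
move=> k; apply: count_le_counting (Sf k) => //.
by move=> m /eqP.
Qed.

Lemma sum_fiber {R : realType} (M : eqType) (D : M -> nat) (n : nat) (f : nat -> R)
    (s : seq M) : (forall m, (D m < n)%N) ->
  \sum_(m <- s) f (D m) = \sum_(k < n) (count (fun m => D m == k) s)%:R * f k.
Proof.
move=> Dn; elim: s => [|m s IH].
  by rewrite big_nil big1// => k _; rewrite mul0r.
rewrite big_cons IH /=.
under [RHS]eq_bigr do rewrite natrD mulrDl.
rewrite big_split /= [X in _ = X + _](bigD1 (Ordinal (Dn m)))//= eqxx mul1r.
rewrite -[LHS]addr0 -addrA [RHS]addrAC -addrA; congr (_ + (_ + _)).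
rewrite big1// => k km.
rewrite (_ : (_ == _) = false) ?mul0r//; apply: contraNF km => /eqP mk.
by apply/eqP/val_inj.
Qed.

(** The convex function x^(-s) lies above its tangent at 1. *)
Lemma powRN_ge_tangent {R : realType} (x s : R) : 0 < x -> 0 <= s ->
  1 + s * (1 - x) <= x `^ (- s).
Proof.
move=> x0 s0; rewrite -{2}[x]lnK ?posrE// -expRM.
apply: le_trans (expR_ge1Dx _).
have : ln (1 + (x - 1)) <= x - 1 by apply: le_ln1Dx; lra.
by rewrite addrCA subrr addr0 => /(ler_wpM2l s0); lra.
Qed.

(** The tangent bound at k / (k + 1) makes each term at most (k^(-s) - (k + 1)^(-s)) / s, and the
    sum telescopes. *)
Lemma zeta_sum {R : realType} (s : R) (n : nat) : 0 < s ->
  \sum_(1 <= k < n.+1) (1 + k%:R) `^ (- (1 + s)) <= s^-1.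
Proof.
move=> s0.
have step k : (0 < k)%N ->
    (1 + k%:R) `^ (- (1 + s)) <= s^-1 * (k%:R `^ (- s) - k.+1%:R `^ (- s)).
  move=> k0; have k0' : 0 < k%:R :> R by rewrite ltr0n.
  have k1 : 0 < k.+1%:R :> R by rewrite ltr0n.
  rewrite nat1r -ler_pdivrMl ?invr_gt0// invrK.
  have -> : k%:R `^ (- s) = (k%:R / k.+1%:R) `^ (- s) * k.+1%:R `^ (- s).
    by rewrite -powRM ?divr_ge0 ?(ltW k1)// divfK ?gt_eqF.
  have t := powRN_ge_tangent (divr_gt0 k0' k1) (ltW s0).
  have p0 : 0 <= k.+1%:R `^ (- s) :> R by exact: powR_ge0.
  have -> : k.+1%:R `^ (- (1 + s)) = k.+1%:R^-1 * k.+1%:R `^ (- s) :> R.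
    rewrite opprD powRD; last by rewrite (gt_eqF k1) implybT.
    by rewrite powR_inv1// ltW.
  have e : 1 - k%:R / k.+1%:R = k.+1%:R^-1 :> R.
    by rewrite -natr1; field; rewrite natr1 gt_eqF.
  rewrite e in t; have := ler_wpM2r p0 t; rewrite mulrDl mul1r.
  by rewrite -[s * _ * _]mulrA lerBrDl.
suff h : \sum_(1 <= k < n.+1) (1 + k%:R) `^ (- (1 + s)) <= s^-1 * (1 - n.+1%:R `^ (- s)).
  have si : 0 < s^-1 by rewrite invr_gt0.
  by apply: le_trans h _; rewrite ger_pMr// gerBl powR_ge0.
elim: n => [|n IH]; first by rewrite big_geq// powR1 subrr mulr0.
rewrite big_nat_recr//=; apply: le_trans (lerD IH (step n.+1 _)) _ => //.
by rewrite -mulrDr addrA subrK.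
Qed.

Section ModelSum.
Context {R : realType} (p om om' c : R).
Hypotheses (p6 : 6 < p) (om0 : 0 < om) (om'0 : 0 < om') (c0 : 0 < c).

(** The delta lost in the tail bound: at most om / 2, to keep the sum over dimensions convergent,
    and at most 1/2, which ensures r > 2 and (1 + L)^delta <= 1 + L. *)
Definition loss_exponent : R := Num.min 2^-1 (om / 2).

Let dl := loss_exponent.
Let r := p / 2 - dl.

Lemma loss_exponent_gt0 : 0 < loss_exponent.
Proof. by rewrite lt_min invr_gt0 ltr0n divr_gt0. Qed.

Lemma loss_exponent_le : loss_exponent <= 2^-1.
Proof. by rewrite ge_min lexx. Qed.

Let dlo : dl <= om / 2.
Proof. by rewrite ge_min lexx orbT. Qed.

(** The bound of [excess_bound] for a model with T = t, without its constant and without tau. *)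
Definition model_cost (L t : R) : R := (1 + t) * ((1 + L) * t + 1) `^ (1 - r).

Lemma model_cost_le1 L t : 0 <= L -> 0 <= t -> model_cost L t <= 1.
Proof.
move=> L0 t0; have LT : 0 <= L * t by exact: mulr_ge0.
have y1 : 1 <= (1 + L) * t + 1 by move: LT; lra.
have yp : 0 < (1 + L) * t + 1 by apply: lt_le_trans y1.
apply: (@le_trans _ _ (((1 + L) * t + 1) * ((1 + L) * t + 1) `^ (1 - r))).
  by rewrite ler_wpM2r ?powR_ge0//; move: LT; lra.
rewrite -[X in X * _](powRr1 (ltW yp)) -powRD; last by rewrite (gt_eqF yp) implybT.
rewrite -[leRHS](powRr0 ((1 + L) * t + 1)) ler_powR// /r.
by move: loss_exponent_le p6; rewrite -/dl; lra.
Qed.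

Let C1 : R := (1 + c^-1) * (c / 2) `^ (2 - r).

(** As t >= c, 1 + t is at most (1 + 1/c) t, and t <= Y / (1 + L). This extra division by 1 + L is
    why 1 + L has exponent 1 - r while the dimension has 2 - r. *)
Lemma model_cost_dim L t k : 0 <= L -> (0 < k)%N -> c * k%:R <= t ->
  model_cost L t <= C1 * ((1 + L) `^ (1 - r) * (1 + k%:R) `^ (2 - r)).
Proof.
move=> L0 k0 ct; have k1 : 1 <= k%:R :> R by rewrite ler1n.
have t0 : 0 < t by apply: lt_le_trans ct; rewrite mulr_gt0// ltr0n.
have L1 : 0 < 1 + L by rewrite ltr_wpDr.
set Y := (1 + L) * t + 1.
have Yp : 0 < Y by rewrite addr_gt0// mulr_gt0.
have h1 : 1 + t <= (1 + c^-1) * ((1 + L)^-1 * Y).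
  apply: (@le_trans _ _ ((1 + c^-1) * t)).
    rewrite mulrDl mul1r addrC lerD2l mulrC ler_pdivlMr// mul1r.
    by apply: le_trans ct; rewrite ler_peMr// ltW.
  rewrite ler_wpM2l ?addr_ge0 ?invr_ge0 ?(ltW c0)//.
  by rewrite ler_pdivlMl// /Y lerDl.
have h2 : (c / 2) * ((1 + L) * (1 + k%:R)) <= Y.
  have : c * (1 + k%:R) <= 2 * t.
    apply: (@le_trans _ _ (2 * (c * k%:R))); last by rewrite ler_wpM2l.
    by have := ler_wpM2l (ltW c0) k1; lra.
  by move=> /(ler_wpM2l (ltW L1)); rewrite /Y; lra.
have e1 : 1 - r = -1 + (2 - r) by ring.
have k1p : 0 < 1 + k%:R :> R by rewrite ltr_wpDr.
have rr : 2 - r = - (r - 2) by ring.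
have r2 : 0 <= r - 2 by rewrite /r; move: loss_exponent_le p6; rewrite -/dl; lra.
have LK : 0 < (1 + L) * (1 + k%:R) by rewrite mulr_gt0.
have h3 : Y `^ (2 - r) <= (c / 2) `^ (2 - r) * ((1 + L) `^ (2 - r) * (1 + k%:R) `^ (2 - r)).
  rewrite -[X in _ * X]powRM ?(ltW L1) ?(ltW k1p)// rr.
  by apply: powRN_le h2 => //; rewrite divr_gt0.
rewrite /model_cost -/Y.
have YY : Y * Y `^ (1 - r) = Y `^ (2 - r).
  rewrite -[X in X * _](powRr1 (ltW Yp)) -powRD; last by rewrite (gt_eqF Yp) implybT.
  by congr (_ `^ _); ring.
apply: le_trans (ler_wpM2r (powR_ge0 _ _) h1) _.
rewrite -mulrA -(mulrA _ Y) YY /C1 -[leRHS]mulrA ler_wpM2l ?addr_ge0 ?invr_ge0 ?(ltW c0)//.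
have -> : (1 + L) `^ (1 - r) = (1 + L)^-1 * (1 + L) `^ (2 - r).
  rewrite e1 powRD; last by rewrite (gt_eqF L1) implybT.
  by rewrite powR_inv1// ltW.
have := ler_wpM2l (_ : 0 <= (1 + L)^-1) h3; rewrite invr_ge0 (ltW L1) => /(_ isT).
by move/le_trans; apply; rewrite le_eqVlt; apply/orP; left; apply/eqP; ring.
Qed.

Definition model_const : R := 1 + 2 * C1 * om' `^ (- ((p - 2) / 2)) * (om / 2)^-1.

Lemma model_const_ge0 : 0 <= model_const.
Proof.
rewrite /model_const addr_ge0// !mulr_ge0 ?invr_ge0 ?powR_ge0 ?addr_ge0 ?invr_ge0//.
  exact: ltW.
by rewrite divr_ge0// ltW.
Qed.

Lemma model_sum (M : eqType) (D : M -> nat) (t : M -> R) (n : nat) (s : seq M) (A L : R) :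
  0 < A -> 0 < L -> om' * A `^ (2 / (p - 2)) <= L ->
  (forall m, (D m < n.+1)%N) -> (forall m, c * (D m)%:R <= t m) ->
  (count (fun m => D m == 0%N) s)%:R <= 1 :> R ->
  (forall k, (0 < k)%N -> (count (fun m => D m == k) s)%:R
     <= A * (1 + k%:R) `^ (p / 2 - 3 - om)) ->
  \sum_(m <- s) model_cost L (t m) <= model_const * Num.max L 1.
Proof.
move=> A0 L0 AL Dn Dt N0 Nk.
have L1 : 0 < 1 + L by rewrite addr_gt0.
pose f k := if k == 0%N then 1 else C1 * ((1 + L) `^ (1 - r) * (1 + k%:R) `^ (2 - r)).
have tf m : model_cost L (t m) <= f (D m).
  rewrite /f; case: eqP => [_|/eqP]; last first.
    by rewrite -lt0n => D0; apply: model_cost_dim; rewrite ?(ltW L0).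
  apply: model_cost_le1; rewrite ?(ltW L0)//; apply: le_trans (Dt m).
  by rewrite mulr_ge0// ltW.
apply: (@le_trans _ _ (\sum_(m <- s) f (D m))); first exact: ler_sum.
rewrite (sum_fiber f s Dn) big_ord_recl/= {1}/f eqxx mulr1.
have C10 : 0 <= C1 by rewrite mulr_ge0 ?powR_ge0// addr_ge0// invr_ge0 ltW.
have p2 : 0 < (p - 2) / 2 by move: p6; lra.
(* The lower bound on L gives A <= om'^(-(p-2)/2) (1 + L)^((p-2)/2), and (p-2)/2 + 1 - r = dl <=
   1. *)
have AL' : A * (1 + L) `^ (1 - r) <= om' `^ (- ((p - 2) / 2)) * (1 + L).
  have h : A <= om' `^ (- ((p - 2) / 2)) * (1 + L) `^ ((p - 2) / 2).
    have -> : A = (A `^ (2 / (p - 2))) `^ ((p - 2) / 2).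
      rewrite -powRrM (_ : _ * _ = 1) ?powRr1 ?(ltW A0)//.
      by field; rewrite gt_eqF//; move: p6; lra.
    rewrite powRN -ler_pdivrMl ?invr_gt0 ?powR_gt0// invrK -powRM ?powR_ge0 ?(ltW om'0)//.
    apply: ge0_ler_powR; rewrite ?nnegrE ?(ltW p2) ?(ltW L1) ?mulr_ge0 ?powR_ge0 ?(ltW om'0)//.
    by apply: le_trans AL _; rewrite lerDr.
  apply: le_trans (ler_wpM2r (powR_ge0 _ _) h) _.
  rewrite -mulrA ler_wpM2l ?powR_ge0// -powRD; last by rewrite (gt_eqF L1) implybT.
  rewrite -[leRHS](powRr1 (ltW L1)) ler_powR//; first by rewrite lerDl ltW.
  by rewrite /r; move: loss_exponent_le; rewrite -/dl; lra.
have Lm : 1 + L <= 2 * Num.max L 1.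
  have : L <= Num.max L 1 by rewrite le_max lexx.
  have : 1 <= Num.max L 1 by rewrite le_max lexx orbT.
  lra.
have L1m : 1 <= Num.max L 1 by rewrite le_max lexx orbT.
rewrite /model_const mulrDl mul1r; apply: lerD; first exact: le_trans N0 L1m.
(* The exponents of 1 + k add up to -1 - om + dl <= -(1 + om / 2). *)
apply: (@le_trans _ _ (\sum_(k < n) C1 * (om' `^ (- ((p - 2) / 2)) * (1 + L))
    * (1 + k.+1%:R) `^ (- (1 + om / 2)))).
  apply: ler_sum => k _; rewrite /f /= /bump /= add1n.
  apply: le_trans (ler_wpM2r _ (Nk k.+1 isT)) _.
    by rewrite mulr_ge0// mulr_ge0 ?powR_ge0.
  set K := 1 + k.+1%:R.
  have Kp : 0 < K by rewrite /K ltr_wpDr.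
  have K1 : 1 <= K by rewrite /K lerDl.
  have -> : A * K `^ (p / 2 - 3 - om) * (C1 * ((1 + L) `^ (1 - r) * K `^ (2 - r)))
     = C1 * (A * (1 + L) `^ (1 - r)) * K `^ (p / 2 - 3 - om + (2 - r)).
    have -> : K `^ (p / 2 - 3 - om + (2 - r)) = K `^ (p / 2 - 3 - om) * K `^ (2 - r).
      by rewrite powRD// (gt_eqF Kp) implybT.
    by ring.
  apply: ler_pM; rewrite ?powR_ge0//.
  - by rewrite mulr_ge0// mulr_ge0 ?powR_ge0// ltW.
  - by rewrite ler_wpM2l.
  by rewrite ler_powR// /r; move: dlo; lra.
rewrite -mulr_sumr.
have z : \sum_(k < n) (1 + k.+1%:R) `^ (- (1 + om / 2)) <= (om / 2)^-1.
  have := @zeta_sum _ (om / 2) n (divr_gt0 om0 _); rewrite big_add1 /= big_mkord.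
  by apply; rewrite ltr0n.
apply: (@le_trans _ _ (C1 * (om' `^ (- ((p - 2) / 2)) * (2 * Num.max L 1)) * (om / 2)^-1)).
  apply: ler_pM => //.
  - by rewrite mulr_ge0// mulr_ge0 ?powR_ge0// ltW.
  - by apply: sumr_ge0 => k _; exact: powR_ge0.
  by rewrite ler_wpM2l// ler_wpM2l ?powR_ge0.
by rewrite le_eqVlt; apply/orP; left; apply/eqP; ring.
Qed.

End ModelSum.

(** * Projections and the selection inequality *)

Section SpectralNorm.
Context {R : realType} {n : nat}.
Implicit Types (A : 'M[R]_n) (x : 'cV[R]_n).

Lemma normn_sqr x : normn x ^+ 2 = n%:R^-1 * dot x x.
Proof.
rewrite /normn sqr_sqrtr; last by rewrite mulr_ge0 ?invr_ge0// sumr_ge0// => i _; exact: sqr_ge0.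
by congr (_ * _); apply: eq_bigr => i _; rewrite expr2.
Qed.

Lemma frobenius_bound A x :
  dot (A *m x) (A *m x) <= (\sum_i dot (row i A)^T (row i A)^T) * dot x x.
Proof.
rewrite mulr_suml; apply: ler_sum => i _; rewrite -expr2.
apply: le_trans (cauchy_schwarz (row i A)^T x).
rewrite (_ : (A *m x) i 0 = dot (row i A)^T x)// mxE.
by apply: eq_bigr => j _; rewrite !mxE.
Qed.

(** Needed before [sup] can be used as an upper bound: the all-ones vector gives a member, the
    Frobenius norm a bound. *)
Lemma specnorm_has_sup A : (0 < n)%N ->
  has_sup [set normn (A *m x) / normn x | x in [set x : 'cV[R]_n | x != 0]].
Proof.
move=> n0; split.
  exists (normn (A *m const_mx 1) / normn (const_mx 1 : 'cV_n)).
  exists (const_mx 1) => //=; apply/eqP => /colP /(_ (Ordinal n0)).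
  by rewrite !mxE => /eqP; rewrite oner_eq0.
exists (Num.sqrt (\sum_i dot (row i A)^T (row i A)^T)) => _ [x /= x0 <-].
have xx : 0 < dot x x.
  by rewrite lt0r dot_ge0 andbT; apply: contra_neq x0 => /dot_eq0.
have n0' : 0 < n%:R^-1 :> R by rewrite invr_gt0 ltr0n.
have nx : 0 < normn x.
  by rewrite sqrtr_gt0 mulr_gt0//; apply: lt_le_trans xx _; apply: ler_sum => i _; rewrite expr2.
rewrite ler_pdivrMr// -ler_sqr ?nnegrE ?mulr_ge0 ?sqrtr_ge0//.
have F0 : 0 <= \sum_i dot (row i A)^T (row i A)^T by apply: sumr_ge0 => i _; exact: dot_ge0.
rewrite exprMn !normn_sqr sqr_sqrtr// mulrCA ler_wpM2l ?(ltW n0')//.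
exact: frobenius_bound.
Qed.

Lemma specnorm_le A x : (0 < n)%N ->
  dot (A *m x) (A *m x) <= specnorm A ^+ 2 * dot x x.
Proof.
move=> n0; have [->|x0] := eqVneq x 0; first by rewrite mulmx0 !dot0l mulr0.
have xx : 0 < dot x x.
  by rewrite lt0r dot_ge0 andbT; apply: contra_neq x0 => /dot_eq0.
have n0' : 0 < n%:R^-1 :> R by rewrite invr_gt0 ltr0n.
have nx : 0 < normn x.
  by rewrite sqrtr_gt0 mulr_gt0//; apply: lt_le_trans xx _; apply: ler_sum => i _; rewrite expr2.
have h : normn (A *m x) / normn x <= specnorm A.
  by apply: (sup_upper_bound (specnorm_has_sup A n0)); exists x.
move: h; rewrite ler_pdivrMr// => h.
have s0 : 0 <= specnorm A * normn x by apply: le_trans h; exact: sqrtr_ge0.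
have : normn (A *m x) ^+ 2 <= (specnorm A * normn x) ^+ 2.
  by rewrite ler_sqr ?nnegrE ?sqrtr_ge0.
by rewrite exprMn !normn_sqr mulrCA ler_pM2l.
Qed.

End SpectralNorm.

Section OrthogonalProjection.
Context {R : realType} {n : nat} (V : {vspace 'cV[R]_n}) (Q : 'M[R]_n).
Hypothesis projQ : is_orthoproj V Q.
Implicit Types x y z : 'cV[R]_n.

Lemma orthoproj_dot x z : dot (x - Q *m x) (Q *m z) = 0.
Proof. by apply: (projQ x).2; exact: (projQ z).1. Qed.

Lemma orthoproj_sqr x : dot x (Q *m x) = dot (Q *m x) (Q *m x).
Proof. by apply/eqP; rewrite -subr_eq0 -dotBl orthoproj_dot. Qed.

Lemma orthoproj_pythagoras x :
  dot (x - Q *m x) (x - Q *m x) = dot x x - dot (Q *m x) (Q *m x).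
Proof. by rewrite dotBr orthoproj_dot subr0 dotBl (dotC _ x) orthoproj_sqr. Qed.

Lemma orthoproj_le x : dot (Q *m x) (Q *m x) <= dot x x.
Proof. by rewrite -subr_ge0 -orthoproj_pythagoras dot_ge0. Qed.

(** Since <x, Qx> = |Qx|^2 for an orthogonal projection, the trace is the squared Hilbert-Schmidt
    norm of QA. *)
Lemma trprojE (A : 'M[R]_n) : trproj A Q = \sum_i gram (Q *m A) i.
Proof.
rewrite /trproj /mxtrace; apply: eq_bigr => i _.
have e : col i (Q *m A) = Q *m col i A.
  by apply/colP => k; rewrite !mxE; apply: eq_bigr => j _; rewrite !mxE.
rewrite /gram e -orthoproj_sqr -e -mulmxA mxE.
by apply: eq_bigr => k _; rewrite !mxE.
Qed.

Lemma projection_risk s E sg :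
  dot (s - Q *m (s + sg *: E)) (s - Q *m (s + sg *: E))
  = dot (s - Q *m s) (s - Q *m s) + sg ^+ 2 * dot (Q *m E) (Q *m E).
Proof.
rewrite mulmxDr -scalemxAr opprD addrA.
set u := s - Q *m s; have uE : dot u (Q *m E) = 0 by exact: orthoproj_dot.
clearbody u.
rewrite dotBl !dotBr !dotZl !dotZr uE (dotC _ u) uE; ring.
Qed.

Lemma projection_residual s E sg :
  let Y := s + sg *: E in
  dot (Y - Q *m Y) (Y - Q *m Y) = dot (s - Q *m s) (s - Q *m s)
    + 2 * sg * dot (s - Q *m s) E + sg ^+ 2 * dot E E - sg ^+ 2 * dot (Q *m E) (Q *m E).
Proof.
move=> /=; rewrite mulmxDr -scalemxAr opprD addrACA -scalerBr.
set u := s - Q *m s; have uE : dot u (Q *m E) = 0 by exact: orthoproj_dot.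
clearbody u.
rewrite dotDl !dotDr !dotZl !dotZr orthoproj_pythagoras dotBl dotBr uE.
rewrite (dotC E u) (dotC _ u) uE; ring.
Qed.

End OrthogonalProjection.

(* The direction [P' u / (rho |u|)] along which the cross term is controlled;
   it is [0] when [u = 0]. *)
Definition bias_form {R : realType} {n : nat} (A : 'M[R]_n) (rho : R) (u : 'cV[R]_n)
  : 'M[R]_(1, n) := (rho^-1 / Num.sqrt (dot u u)) *: (u^T *m A).

Section NormalizedForms.
Context {R : realType} {n : nat} (A : 'M[R]_n) (rho : R).
Hypothesis rho0 : 0 < rho.
Hypothesis Arho : forall x : 'cV[R]_n, dot (A *m x) (A *m x) <= rho ^+ 2 * dot x x.

Lemma nonexpansive_scaled V Q : is_orthoproj V Q ->
  nonexpansive (rho^-1 *: (Q *m A)).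
Proof.
move=> projQ x; rewrite -scalemxAl dotZl dotZr mulrA -mulmxA.
apply: le_trans (ler_wpM2l (_ : 0 <= rho^-1 * rho^-1) (orthoproj_le projQ (A *m x))) _.
  by rewrite mulr_ge0// invr_ge0 ltW.
apply: le_trans (ler_wpM2l (_ : 0 <= rho^-1 * rho^-1) (Arho x)) _.
  by rewrite mulr_ge0// invr_ge0 ltW.
by rewrite le_eqVlt; apply/orP; left; apply/eqP; field; rewrite gt_eqF.
Qed.

Lemma gram_scaled k (B : 'M[R]_n) i : gram (k *: B) i = k ^+ 2 * gram B i.
Proof.
rewrite /gram (_ : col i (k *: B) = k *: col i B); last by apply/colP => j; rewrite !mxE.
by rewrite dotZl dotZr mulrA -expr2.
Qed.

Lemma bias_formE u x : dot (bias_form A rho u *m x) (bias_form A rho u *m x)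
  = rho ^- 2 * (dot u (A *m x) ^+ 2 / dot u u).
Proof.
rewrite /bias_form -scalemxAl dotZl dotZr -mulmxA.
have -> : dot (u^T *m (A *m x)) (u^T *m (A *m x)) = dot u (A *m x) ^+ 2.
  rewrite {1}/dot big_ord1 -expr2 mxE; congr (_ ^+ 2).
  by apply: eq_bigr => j _; rewrite mxE.
rewrite mulrA -expr2 exprMn exprVn exprVn sqr_sqrtr ?dot_ge0//; ring.
Qed.

Lemma nonexpansive_bias u : nonexpansive (bias_form A rho u).
Proof.
move=> x; rewrite bias_formE.
have [u0|u0] := eqVneq u 0; first by rewrite u0 dot0l expr0n mul0r mulr0 dot_ge0.
have uu : 0 < dot u u.
  by rewrite lt0r dot_ge0 andbT; apply: contra_neq u0 => /dot_eq0.
have r2 : 0 < rho ^+ 2 by rewrite exprn_gt0.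
rewrite ler_pdivrMl// ler_pdivrMr// mulrC; apply: le_trans (cauchy_schwarz _ _) _.
by rewrite ler_wpM2l ?dot_ge0.
Qed.

(** For a single row the sum is |a' 1|^2, bounded through the transpose. *)
Lemma sum_gram_form (a : 'M[R]_(1, n)) : nonexpansive a -> \sum_i gram a i <= 1.
Proof.
move=> ca; have := nonexpansive_tr ca (const_mx 1).
rewrite [leRHS]/dot big_ord1 mxE mul1r; apply: le_trans.
rewrite [leRHS]/dot; apply: ler_sum => i _.
by rewrite /gram /dot !big_ord1 !mxE big_ord1 !mxE mulr1.
Qed.

End NormalizedForms.

(** Young's inequality with weight [al], then 1 / al <= 2. For u = 0 the quotient is 0 by convention
    and both sides vanish. *)
Lemma cross_term_le {R : realType} {n : nat} (u E : 'cV[R]_n) (sg al : R) :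
  2^-1 <= al -> - (2 * sg * dot u E) <= al * dot u u
    + 2 * sg ^+ 2 * (dot u E ^+ 2 / dot u u).
Proof.
move=> al2; have al0 : 0 < al by apply: lt_le_trans al2; rewrite invr_gt0.
have [->|u0] := eqVneq u 0; first by rewrite !dot0l expr0n mul0r !mulr0 oppr0 addr0.
have uu : 0 < dot u u.
  by rewrite lt0r dot_ge0 andbT; apply: contra_neq u0 => /dot_eq0.
set U := dot u u in uu *; set e := dot u E.
have h1 : - (2 * sg * e) <= al * U + sg ^+ 2 * (e ^+ 2 / U) / al.
  rewrite -subr_ge0.
  have -> : al * U + sg ^+ 2 * (e ^+ 2 / U) / al - - (2 * sg * e) =
     al * U * (1 + sg * e / (al * U)) ^+ 2 by field; rewrite !gt_eqF.
  by rewrite mulr_ge0 ?sqr_ge0// mulr_ge0// ltW.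
apply: le_trans h1 _; rewrite lerD2l.
have q0 : 0 <= sg ^+ 2 * (e ^+ 2 / U).
  by rewrite mulr_ge0 ?sqr_ge0// divr_ge0 ?sqr_ge0// ltW.
rewrite -(mulrA 2); move: q0; set q := sg ^+ 2 * _ => q0.
by rewrite ler_pdivrMr//; have := ler_wpM2l q0 al2; lra.
Qed.

(* No measurability: for nonnegative functions the integral is by definition a
   supremum over the simple functions below. *)
Lemma ge0_integral_monotone d (T : measurableType d) (R : realType)
    (mu : {measure set T -> \bar R}) (f g : T -> \bar R) :
  (forall t, 0 <= f t)%E -> (forall t, f t <= g t)%E ->
  (\int[mu]_t f t <= \int[mu]_t g t)%E.
Proof.
move=> f0 fg; have g0 t : (0 <= g t)%E by apply: le_trans (fg t).
rewrite !ge0_integralTE//; apply: le_ereal_sup => _ [h /= hf <-].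
by exists h => //= t; apply: le_trans (fg t).
Qed.

Lemma ereal_le_inf {R : realType} (E : \bar R) (K : R) (S : set R) :
  (0 <= E)%E -> 0 < K -> S !=set0 -> (forall x, S x -> (E <= (K * x)%:E)%E) ->
  (E <= (K * inf S)%:E)%E.
Proof.
move=> E0 K0 [x0 Sx0] ES; have := ES _ Sx0; case: E E0 ES => [e| |] //= E0 ES _.
rewrite lee_fin mulrC -ler_pdivrMr//; apply: lb_le_inf; first by exists x0.
by move=> x /ES; rewrite lee_fin mulrC -ler_pdivrMr.
Qed.

Section NoiseMoments.
Context {d : measure_display} {T : measurableType d} {R : realType}.
Variables (P : probability T R) (X : {RV P >-> R}) (p tau : R).
Hypotheses (EX : ('E_P[X] = 0)%E) (VX : ('V_P[X] = 1)%E) (p2 : 2 < p).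
Hypothesis Xp : ('E_P[fun t => (`|X t| `^ p)%R] = tau%:E)%E.

Let mX : measurable_fun setT (X : T -> R). Proof. exact: measurable_funPT. Qed.

Lemma noise_second_moment : (\int[P]_t (X t ^+ 2)%:E = 1)%E.
Proof.
rewrite -VX /variance covariance.unlock EX/= expectation.unlock.
by apply: eq_integral => t _; rewrite -[RHS]/(((X t - 0) * (X t - 0))%:E) subr0 expr2.
Qed.

Lemma noise_integrable : P.-integrable setT (EFin \o X).
Proof.
apply/integrableP; split; first exact/measurable_EFinP.
apply: (@le_lt_trans _ _ (\int[P]_t (1 + X t ^+ 2)%:E)%E).
  apply: ge0_integral_monotone => t; rewrite /= ?abse_ge0// lee_fin.
  by have := sqr_ge0 (`|X t| - 1); rewrite -[X t ^+ 2]real_normK ?num_real//; nra.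
under eq_integral => t _ do rewrite EFinD.
rewrite ge0_integralD//=.
- by rewrite integral_cst_prob noise_second_moment -EFinD ltry.
- by move=> t _; rewrite lee_fin sqr_ge0.
- by apply/measurable_EFinP; exact: measurable_funX.
Qed.

(** Young's inequality X^2 <= (2/p) |X|^p + 1 - 2/p, integrated against unit variance. It allows tau
    to multiply the deterministic terms of the risk. *)
Lemma noise_moment_ge1 : 1 <= tau.
Proof.
have p0 : 0 < p by apply: lt_trans p2.
have q1 : 0 < 1 - 2 / p by rewrite subr_gt0 ltr_pdivrMr// mul1r.
have young t : X t ^+ 2 <= (2 / p) * `|X t| `^ p + (1 - 2 / p).
  have := @conjugate_powR _ (X t ^+ 2) 1 (p / 2) (1 - 2 / p)^-1 (sqr_ge0 _) ler01
    (divr_gt0 p0 (ltr0n _ 2)) .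
  rewrite invr_gt0 => /(_ q1); rewrite invrK invf_div => /(_ (subrKC _ _)).
  rewrite mulr1 powR1 mul1r => /le_trans; apply.
  rewrite -[X t ^+ 2]real_normK ?num_real// -powR_mulrn// -powRrM.
  have -> : 2%:R * (p / 2) = p by rewrite mulrCA divff ?mulr1.
  by rewrite mulrC.
have : (\int[P]_t (X t ^+ 2)%:E <= \int[P]_t ((2 / p) * `|X t| `^ p + (1 - 2 / p))%:E)%E.
  by apply: ge0_integral_monotone => t; rewrite lee_fin ?sqr_ge0.
have c0 : 0 <= 2 / p by rewrite divr_ge0// ltW.
have mXp : measurable_fun setT (EFin \o (fun t => `|X t| `^ p)).
  apply/measurable_EFinP.
  apply: (measurableT_comp (measurable_powR p)).
  exact: measurableT_comp (@normr_measurable R setT) mX.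
rewrite noise_second_moment.
under eq_integral => t _ do rewrite EFinD EFinM.
rewrite ge0_integralD//=.
- rewrite ge0_integralZl//.
  have -> : (\int[P]_t (`|X t| `^ p)%:E = tau%:E)%E by rewrite -Xp expectation.unlock.
  rewrite integral_cst_prob -EFinM -EFinD lee_fin => h.
  have : (2 / p) * 1 <= (2 / p) * tau by move: h; lra.
  by rewrite ler_pM2l// divr_gt0.
- by move=> t _; rewrite -EFinM lee_fin mulr_ge0// powR_ge0.
- exact: measurable_funeM.
- by move=> t _; rewrite lee_fin ltW.
Qed.

End NoiseMoments.

Section Selection.
Context {R : realType} {n : nat} (M : Type).
Variables (S : M -> {vspace 'cV[R]_n}) (pi_ : M -> 'M[R]_n) (A : 'M[R]_n).
Variables (s e : 'cV[R]_n) (sg theta L rho : R) (mh m : M).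
Hypotheses (n0 : (0 < n)%N) (theta0 : 0 < theta) (rho0 : 0 < rho).
Hypothesis projS : forall m, is_orthoproj (S m) (pi_ m).

Let Y := s + sg *: (A *m e).
Let pen k := (1 + theta + L) * (trproj A (pi_ k) / n%:R) * sg ^+ 2.

Hypothesis mh_min : normn (Y - pi_ mh *m Y) ^+ 2 + pen mh
  <= normn (Y - pi_ m *m Y) ^+ 2 + pen m.

Let W k := rho^-1 *: (pi_ k *m A).
Let u k := s - pi_ k *m s.

(** A share 1 - eta of the squared bias of the selected model pays for its cross term. The share eta
    that is left, together with eta times the variance term, makes up the left side; hence the
    coefficient 1 + eta in the excess. *)
Lemma selection_bound :
  margin theta * dot (s - pi_ mh *m Y) (s - pi_ mh *m Y) <=
  dot (u m) (u m) + 2 * sg * dot (u m) (A *m e)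
  + (1 + theta + L) * trproj A (pi_ m) * sg ^+ 2
  + sg ^+ 2 * rho ^+ 2 * Num.max ((1 + margin theta) * dot (W mh *m e) (W mh *m e)
    + 2 * dot (bias_form A rho (u mh) *m e) (bias_form A rho (u mh) *m e)
    - (1 + theta + L) * \sum_i gram (W mh) i) 0.
Proof.
have mu2 := margin_half theta; have mu0 := margin_gt0 theta0.
set mu := margin theta in mu2 mu0 *.
have nn : 0 < n%:R :> R by rewrite ltr0n.
set G := Num.max _ 0.
have Gge : sg ^+ 2 * rho ^+ 2 * ((1 + mu) * dot (W mh *m e) (W mh *m e)
    + 2 * dot (bias_form A rho (u mh) *m e) (bias_form A rho (u mh) *m e)
    - (1 + theta + L) * \sum_i gram (W mh) i) <= sg ^+ 2 * rho ^+ 2 * G.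
  have sr0 : 0 <= sg ^+ 2 * rho ^+ 2 by rewrite mulr_ge0 ?sqr_ge0.
  by rewrite (ler_wpM2l sr0)// /G le_max lexx.
have WE : dot (W mh *m e) (W mh *m e) = rho ^- 2 * dot (pi_ mh *m (A *m e)) (pi_ mh *m (A *m e)).
  by rewrite /W -scalemxAl dotZl dotZr -mulmxA mulrA -exprVn expr2.
have gE : \sum_i gram (W mh) i = rho ^- 2 * trproj A (pi_ mh).
  rewrite (trprojE (projS mh)) mulr_sumr; apply: eq_bigr => i _.
  by rewrite /W gram_scaled exprVn.
move: Gge; rewrite WE gE bias_formE.
set E := A *m e; set B := dot (u mh) E ^+ 2 / dot (u mh) (u mh).
have r2 : rho ^+ 2 != 0 by rewrite expf_neq0// gt_eqF.
have -> : sg ^+ 2 * rho ^+ 2 *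
   ((1 + mu) * (rho ^- 2 * dot (pi_ mh *m E) (pi_ mh *m E)) + 2 * (rho ^- 2 * B) -
    (1 + theta + L) * (rho ^- 2 * trproj A (pi_ mh)))
  = sg ^+ 2 * ((1 + mu) * dot (pi_ mh *m E) (pi_ mh *m E) + 2 * B
    - (1 + theta + L) * trproj A (pi_ mh)) by field; rewrite gt_eqF.
move=> Gge.
rewrite (projection_risk (projS mh)) -/(u mh).
have := mh_min; rewrite !normn_sqr /pen.
have penE k : (1 + theta + L) * (trproj A (pi_ k) / n%:R) * sg ^+ 2
   = n%:R^-1 * ((1 + theta + L) * trproj A (pi_ k) * sg ^+ 2) by ring.
rewrite !penE -!mulrDr ler_pM2l ?invr_gt0//.
rewrite /Y -/E (projection_residual (projS mh)) (projection_residual (projS m)) -!/(u _).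
have al2 : 2^-1 <= 1 - mu by move: mu2; lra.
have := cross_term_le (u mh) E sg al2; rewrite -/B.
have := dot_ge0 (pi_ m *m E); have s2 := sqr_ge0 sg => /(mulr_ge0 s2).
move: Gge; move: s2.
set Qm := dot (pi_ m *m E) _; set Qh := dot (pi_ mh *m E) _.
by lra.
Qed.

End Selection.

(** * Assembly of the risk bound *)

Lemma integral_affine_le d (T : measurableType d) (R : realType)
    (P : probability T R) (n : nat) (eps : 'I_n -> {RV P >-> R}) (M : Type)
    (ms : seq M) (H : M -> T -> R) (B : M -> R) (K ka : R) (a : 'I_n -> R) :
  (forall i, P.-integrable setT (EFin \o eps i)) ->
  (forall i, \int[P]_t (eps i t)%:E = 0)%E ->
  (forall k, measurable_fun setT (H k)) -> (forall k t, 0 <= H k t) ->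
  (forall k, \int[P]_t (H k t)%:E <= (B k)%:E)%E -> 0 <= ka ->
  (\int[P]_t (K + \sum_i a i * eps i t + ka * \sum_(k <- ms) H k t)%:E
    <= (K + ka * \sum_(k <- ms) B k)%:E)%E.
Proof.
move=> ieps eps1 mH H0 HB ka0.
have iH k : P.-integrable setT (EFin \o H k).
  apply/integrableP; split; first exact/measurable_EFinP.
  apply: le_lt_trans (ltry (B k)); apply: le_trans (HB k).
  by apply: ge0_integral_monotone => t; rewrite /= ?abse_ge0// ger0_norm.
have isum : P.-integrable setT (fun t => \sum_(k <- ms) (H k t)%:E)%E.
  by apply: integrable_sum => // k _; exact: iH.
have ilin : P.-integrable setT (fun t => \sum_i (a i)%:E * (eps i t)%:E)%E.
  by apply: integrable_sum => // i _; apply: integrableZl => //; exact: ieps.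
have icst : P.-integrable setT (fun=> K%:E : \bar R) by exact: finite_measure_integrable_cst.
rewrite (_ : (fun t => _) = (fun t => (K%:E + \sum_i (a i)%:E * (eps i t)%:E)
    + ka%:E * \sum_(k <- ms) (H k t)%:E)%E); last first.
  apply/funext => t; rewrite !EFinD EFinM -!sumEFin; congr (_ + _ + _)%E.
rewrite integralD//; [|exact: integrableD|exact: integrableZl].
rewrite integralD// integral_cst_prob.
rewrite integral_sum//; last by move=> i; apply: integrableZl => //; exact: ieps.
rewrite big1 ?adde0; last first.
  by move=> i _; rewrite integralZl//; [rewrite eps1 mule0|exact: ieps].
rewrite integralZl// integral_sum//.
rewrite [leRHS]EFinD EFinM -sumEFin leeD2l// lee_wpmul2l ?lee_fin//.
by apply: lee_sum => k _; exact: HB.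
Qed.

Lemma probability_inhabited d (T : measurableType d) (R : realType)
  (P : probability T R) : exists t : T, True.
Proof.
apply: contrapT => Tn; have : P [set: T] = 0%E.
  rewrite (_ : [set: T] = set0) ?measure0//.
  by apply/seteqP; split=> t // _; case: Tn; exists t.
by rewrite probability_setT => /eqP; rewrite onee_eq0.
Qed.

Lemma ndim_le {R : realType} (n : nat) (M : countType)
    (S : M -> {vspace 'cV[R]_n}) (A e : R) :
  0 < A -> (ndim S 0 <= 1)%E ->
  (ereal_sup [set ndim S k * (((1 + k%:R) `^ e)^-1)%:E
             | k in [set k : nat | (0 < k)%N /\ 0 < ndim S k]] <= A%:E)%E ->
  forall k, (ndim S k <= (if k == 0%N then 1 else A * (1 + k%:R) `^ e)%:E)%E.
Proof.
move=> A0 N0 NA k; case: eqP => [->//|/eqP]; rewrite -lt0n => k0.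
have e0 : 0 < (1 + k%:R) `^ e :> R by rewrite powR_gt0// ltr_wpDr.
have [Nk|Nk] := ltP 0%E (ndim S k); last first.
  by apply: le_trans Nk _; rewrite lee_fin mulr_ge0// ltW.
rewrite EFinM -lee_pdivrMr//; apply: le_trans NA.
by apply: ereal_sup_ubound; exists k.
Qed.

(** Everything is compared with U + Lm V sg2; the summed excess has no trace factor, and r2 <= V / c
    brings it under the same bound. The final [+ 1] makes C > 1 immediate. *)
Lemma risk_constant_le {R : realType} (mu theta L Lm c tau Ce Cm nn U tr V r2 sg2 : R) :
  0 < mu -> 0 < theta -> 0 < c -> 0 <= Ce -> 0 <= Cm -> 1 <= tau -> 0 <= nn -> 0 <= U ->
  0 <= tr -> tr <= V -> c * r2 <= V -> 0 <= sg2 -> L <= Lm -> 1 <= Lm ->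
  (mu^-1 * nn) * (U + (1 + theta + L) * tr * sg2)
    + (mu^-1 * nn) * (sg2 * r2) * (Ce * tau * (Cm * Lm))
  <= (mu^-1 * (1 + (2 + theta) + Ce * Cm / c) + 1) * tau * (nn * U + Lm * (V * nn) * sg2).
Proof.
move=> mu0 th0 c0 Ce0 Cm0 tau1 nn0 U0 tr0 trV rV sg0 LLm Lm1.
have V0 : 0 <= V by apply: le_trans trV.
have Lm0 : 0 <= Lm by apply: le_trans Lm1.
have tau0 : 0 <= tau by apply: le_trans tau1.
pose X := U + Lm * V * sg2.
have X0 : 0 <= X by rewrite addr_ge0// !mulr_ge0.
have LV : Lm * V * sg2 <= X by rewrite lerDr.
have h1 : (1 + theta + L) * tr * sg2 <= (2 + theta) * X.
  apply: (@le_trans _ _ ((2 + theta) * (Lm * V * sg2))); last first.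
    by rewrite ler_wpM2l// addr_ge0// ltW.
  rewrite mulrA ler_wpM2r// mulrA.
  apply: (@le_trans _ _ ((2 + theta) * Lm * tr)); last first.
    by rewrite ler_wpM2l// mulr_ge0// addr_ge0// ltW.
  rewrite ler_wpM2r//; have := ler_wpM2l (ltW th0) Lm1; lra.
have h2 : sg2 * r2 * (Ce * tau * (Cm * Lm)) <= tau * (Ce * Cm / c) * X.
  apply: (@le_trans _ _ (tau * (Ce * Cm / c) * (Lm * V * sg2))); last first.
    by rewrite ler_wpM2l// mulr_ge0// divr_ge0 ?mulr_ge0// ltW.
  have -> : sg2 * r2 * (Ce * tau * (Cm * Lm))
     = tau * (Ce * Cm / c) * (Lm * (c * r2) * sg2) by field; rewrite gt_eqF.
  rewrite ler_wpM2l//; first by rewrite mulr_ge0// divr_ge0 ?mulr_ge0// ltW.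
  by rewrite ler_wpM2r// ler_wpM2l.
have h3 : U + (1 + theta + L) * tr * sg2 + sg2 * r2 * (Ce * tau * (Cm * Lm))
    <= tau * (1 + (2 + theta) + Ce * Cm / c) * X.
  have UX : U <= X by rewrite lerDl !mulr_ge0.
  have : (1 + (2 + theta)) * X <= tau * ((1 + (2 + theta)) * X).
    by rewrite ler_peMl// mulr_ge0// addr_ge0// addr_ge0// ltW.
  by move: h1 h2; lra.
have m0 : 0 <= mu^-1 * nn by rewrite mulr_ge0// invr_ge0 ltW.
have := ler_wpM2l m0 h3.
have : 0 <= tau * nn * X by rewrite !mulr_ge0.
rewrite /X; lra.
Qed.

Theorem corollary2p2 (R : realType) (theta p omega omega' c : R)
    (htheta : 0 < theta) (hp : 6 < p) (homega : 0 < omega)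
    (homega' : 0 < omega') (hc0 : 0 < c) (hc1 : c < 1) :
  exists C : R, 1 < C /\
  forall (n : nat) (Pn : 'M[R]_n) (s : 'cV[R]_n) (sigma : R)
    (d : measure_display) (T : measurableType d) (P : probability T R)
    (eps : 'I_n -> {RV P >-> R}) (tau : R)
    (M : countType) (S : M -> {vspace 'cV[R]_n}) (pi_ : M -> 'M[R]_n)
    (A L : R) (mhat : T -> M),
  let Y := observation Pn s sigma (fun i => eps i : T -> R) in
  let pen := fun m : M =>
    (1 + theta + L) * (trproj Pn (pi_ m) / n%:R) * sigma ^+ 2 in
  (0 < n)%N ->
  s \in immx Pn ->
  0 < sigma ->
  mutually_independent eps ->
  identically_distributed eps ->
  (forall i, 'E_P[eps i] = 0)%E ->
  (forall i, 'V_P[eps i] = 1)%E ->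
  (forall i, 'E_P[fun w => (`|eps i w| `^ p)%R] = tau%:E)%E ->
  (forall m, S m <= immx Pn)%VS ->
  (forall m, is_orthoproj (S m) (pi_ m)) ->
  (forall m, c * specnorm Pn ^+ 2 * (\dim (S m))%:R <= trproj Pn (pi_ m)) ->
  0 < A ->
  (ndim S 0 <= 1)%E ->
  (ereal_sup [set ndim S k * (((1 + k%:R) `^ (p / 2 - 3 - omega))^-1)%:E
             | k in [set k : nat | (0 < k)%N /\ 0 < ndim S k]] <= A%:E)%E ->
  0 < L ->
  omega' * A `^ (2 / (p - 2)) <= L ->
  is_selection pi_ pen Y mhat ->
  ('E_P[fun w => (normn (s - pi_ (mhat w) *m Y w) ^+ 2)%R] <=
   (C * tau *
    inf [set normn (s - pi_ m *m s) ^+ 2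
             + Num.max L 1
               * (Num.max (trproj Pn (pi_ m)) (c * specnorm Pn ^+ 2) / n%:R)
               * sigma ^+ 2
        | m in [set: M]])%:E)%E.
Proof.
have p2 : 2 <= p by move: hp; lra.
have [dl0 dl2] := (loss_exponent_gt0 homega, loss_exponent_le omega).
have dlp : loss_exponent omega < p / 2 - 1 by move: dl2 hp; lra.
have [Ce Ce0 exc] := excess_bound p2 dl0 dlp htheta.
have Cm0 : 0 <= model_const p omega omega' c by exact: model_const_ge0.
set Cm := model_const _ _ _ _ in Cm0.
have mu0 := margin_gt0 htheta.
set C := (margin theta)^-1 * (1 + (2 + theta) + Ce * Cm / c) + 1.
have C1 : 1 < C.
  rewrite /C ltrDr mulr_gt0 ?invr_gt0// ltr_pwDl ?divr_ge0 ?mulr_ge0 ?(ltW hc0)//.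
  by rewrite !addr_gt0.
exists C; split => // n Pn s sigma d T P eps tau M S pi_ A L mhat Y pen.
move=> n0 sIm sg0 indep _ E1 V1 Ep _ proj Tr A0 N0 NA L0 AL sel.
have i0 := Ordinal n0.
have tau1 : 1 <= tau by apply: (noise_moment_ge1 (E1 i0) (V1 i0) _ (Ep i0)); move: hp; lra.
have tau0 : 0 < tau by apply: lt_le_trans tau1.
have nn : 0 < n%:R :> R by rewrite ltr0n.
have Lm1 : 1 <= Num.max L 1 by rewrite le_max lexx orbT.
have tr0 m : 0 <= trproj Pn (pi_ m).
  by rewrite (trprojE (proj m)) sumr_ge0// => i _; exact: dot_ge0.
(* An outcome provides the model [mhat t0], so the infimum is over a nonempty set. *)
have [t0 _] := probability_inhabited P.
apply: ereal_le_inf.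
- by apply: expectation_ge0 => w; exact: sqr_ge0.
- by rewrite mulr_gt0// (lt_trans _ C1).
- by eexists; exists (mhat t0).
move=> _ [m _ <-].
set V := Num.max (trproj _ _) _.
have V0 : 0 <= V by rewrite le_max tr0.
(* The forms are normalized by the spectral norm; when it is 0, the operator and hence s vanish, and
   so does the loss. *)
have [rho0|rho0] := eqVneq (specnorm Pn) 0.
  have P0 (x : 'cV[R]_n) : Pn *m x = 0.
    apply: dot_eq0; apply/eqP; rewrite eq_le dot_ge0 andbT.
    by have := specnorm_le Pn x n0; rewrite rho0 expr0n mul0r.
  have s0 : s = 0 by move: sIm => /memv_imgP[x _ ->]; rewrite lfunE /= P0.
  rewrite (_ : (fun w => _) = cst 0) ?expectation_cst; last first.
    apply/funext => w; rewrite normn_sqr /Y /observation P0 s0 scaler0 addr0 mulmx0 subr0.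
    by rewrite dot0l mulr0.
  rewrite lee_fin mulr_ge0 ?mulr_ge0 ?(ltW tau0) ?(ltW (lt_trans ltr01 C1))//.
  rewrite addr_ge0 ?sqr_ge0// mulr_ge0 ?sqr_ge0// mulr_ge0 ?divr_ge0//.
  exact: le_trans Lm1.
(* Only the square of the spectral norm matters; the absolute value yields positivity at once. *)
pose rho := `|specnorm Pn|.
have rhop : 0 < rho by rewrite normr_gt0.
have rho2 : rho ^+ 2 = specnorm Pn ^+ 2 by rewrite real_normK// num_real.
have Arho (x : 'cV[R]_n) : dot (Pn *m x) (Pn *m x) <= rho ^+ 2 * dot x x.
  by rewrite rho2; exact: specnorm_le.
have [ms [ums msM msN]] := finite_models (ndim_le A0 N0 NA).
pose W k := rho^-1 *: (pi_ k *m Pn).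
pose a k := bias_form Pn rho (s - pi_ k *m s).
pose t k := \sum_i gram (W k) i.
have tE k : t k = rho ^- 2 * trproj Pn (pi_ k).
  rewrite (trprojE (proj k)) mulr_sumr; apply: eq_bigr => i _.
  by rewrite /W gram_scaled exprVn.
pose H k w := Num.max ((1 + margin theta) * quad eps (W k) w + 2 * quad eps (a k) w
  - (1 + theta + L) * t k) 0.
have ieps i := noise_integrable (E1 i) (V1 i).
have eps1 i : (\int[P]_w (eps i w)%:E = 0)%E by rewrite -(E1 i) expectation.unlock.
have eps2 i := noise_second_moment (E1 i) (V1 i).
pose B k := Ce * tau * model_cost p omega L (t k).
have HB k : (\int[P]_w (H k w)%:E <= (B k)%:E)%E.
  apply: le_trans (exc d T P n n eps (W k) (a k) tau L indep ieps eps1 eps2 _ tau1 _ _ _ _) _.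
  - by move=> i; rewrite Ep.
  - exact: nonexpansive_scaled (proj k).
  - exact: nonexpansive_bias.
  - by apply: sum_gram_form; exact: nonexpansive_bias.
  - exact: ltW.
  by rewrite lee_fin /B /model_cost !mulrA.
have SB : \sum_(k <- ms) B k <= Ce * tau * (Cm * Num.max L 1).
  rewrite -mulr_sumr ler_wpM2l ?mulr_ge0 ?(ltW tau0)//.
  apply: (model_sum (D := fun k : M => \dim (S k)) (n := n) hp homega homega' hc0 A0 L0 AL).
  - by move=> k; rewrite ltnS; have := dimvS (subvf (S k)); rewrite dimvf /dim /= muln1.
  - move=> k; rewrite tE ler_pdivlMl ?exprn_gt0//; apply: le_trans (Tr k).
    by rewrite rho2 le_eqVlt; apply/orP; left; apply/eqP; ring.
  - exact: (msN 0%N).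
  - by move=> k k0; have := msN k; rewrite gtn_eqF.
have mH k : measurable_fun setT (H k).
  apply: measurable_maxr => //; apply: measurable_funB => //.
  by apply: measurable_funD; apply: measurable_funM => //; exact: measurable_quad.
have H0 k w : 0 <= H k w by rewrite le_max lexx orbT.
pose u := s - pi_ m *m s.
pose c1 := (margin theta)^-1 * n%:R^-1.
have c10 : 0 <= c1 by rewrite mulr_ge0 ?invr_ge0// ltW.
pose K := c1 * (dot u u + (1 + theta + L) * trproj Pn (pi_ m) * sigma ^+ 2).
(* The cross term of the fixed model [m] is linear in the noise, and its expectation is 0. *)
pose al i := c1 * (2 * sigma * (Pn^T *m u) i 0).
pose ka := c1 * (sigma ^+ 2 * rho ^+ 2).
have ka0 : 0 <= ka by rewrite mulr_ge0// mulr_ge0 ?sqr_ge0.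
have bound w : normn (s - pi_ (mhat w) *m Y w) ^+ 2
    <= K + \sum_i al i * eps i w + ka * \sum_(k <- ms) H k w.
  have lin : \sum_i al i * eps i w = c1 * (2 * sigma * dot u (Pn *m noise eps w)).
    rewrite dotC dot_mulmx /dot !mulr_sumr; apply: eq_bigr => i _.
    by rewrite /al [noise eps w i 0]mxE; ring.
  (* The random index disappears by summing the nonnegative excesses over all models, which makes
     the upper bound measurable for any selection. *)
  have Hs : H (mhat w) w <= \sum_(k <- ms) H k w.
    by rewrite (bigD1_seq (mhat w))//= lerDl sumr_ge0.
  have := selection_bound (s := s) (e := noise eps w) (sg := sigma) (L := L)
    n0 htheta rhop proj (sel w m).
  rewrite -/u -/(W _) -/(a _) -/(t _) -/(quad eps _ w) -/(H (mhat w) w) => sb.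
  rewrite normn_sqr lin.
  have := ler_wpM2l c10 sb; rewrite mulrA.
  have -> : c1 * margin theta = n%:R^-1 by rewrite /c1 mulrAC mulVf ?mul1r// gt_eqF.
  move=> /le_trans; apply.
  have := ler_wpM2l ka0 Hs; rewrite /K /ka; lra.
rewrite expectation.unlock.
apply: (@le_trans _ _ (\int[P]_w
    (K + \sum_i al i * eps i w + ka * \sum_(k <- ms) H k w)%:E)%E).
  by apply: ge0_integral_monotone => w; rewrite lee_fin; [exact: sqr_ge0|exact: bound].
apply: le_trans (integral_affine_le _ _ _ ieps eps1 mH H0 HB ka0) _.
rewrite lee_fin; apply: (@le_trans _ _ (K + ka * (Ce * tau * (Cm * Num.max L 1)))).
  by rewrite lerD2l ler_wpM2l.
rewrite normn_sqr -/u /V -rho2 /K /ka /c1.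
apply: risk_constant_le; rewrite ?invr_ge0 ?(ltW nn) ?dot_ge0 ?sqr_ge0//.
- by rewrite le_max lexx.
- by rewrite rho2 le_max lexx orbT.
- by rewrite le_max lexx.
Qed.
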